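(* Let $\Omega\subset\mathbb{R}^N$ ($N\ge2$) be a bounded domain with $C^3$ boundary $\Gamma$, and let $\beta_1<1$. Then there exists $s_1\in(0,s_0)$ such that for every $s\in(0,s_1)$, every function $p$ harmonic in $\Omega_s$, and every function $p_0$ that is constant on each connected component of $\Omega_s$, $$\beta_1\int_{\Omega_s}|(I-\vec n\vec n^t)\nabla p|^2\le\int_{\Omega_s}|\vec n\cdot\nabla p|^2+\frac{24}{s^2}\int_{\Omega_s}|p-p_0|^2,$$ where the integrals take values in $[0,\infty]$.
   Context: $\Phi(x)=\operatorname{dist}(x,\Gamma)$ for $x\in\Omega$, and $\Omega_s=\{x\in\Omega:\Phi(x)<s\}$. Since $\Gamma$ is $C^3$ and compact there is $s_0>0$ such that $\Phi$ is $C^3$ on $\Omega_{s_0}$ with $|\nabla\Phi|=1$ there; set $\vec n=-\nabla\Phi$ on $\Omega_{s_0}$ (a $C^2$ unit vector field extending the outward unit normal of $\Gamma$). $\vec n\vec n^t$ is the orthogonal projection onto $\vec n$, so $(I-\vec n\vec n^t)\vec a=\vec a-(\vec n\cdot\vec a)\vec n$. *)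

(* Defs.v *)
From HB Require Import structures.
From mathcomp Require Import all_boot all_order all_algebra.
From mathcomp Require Import all_classical all_reals all_analysis.
Set Implicit Arguments. Unset Strict Implicit. Unset Printing Implicit Defensive.
Import Order.TTheory GRing.Theory Num.Theory.
Import numFieldNormedType.Exports.
Local Open Scope classical_set_scope.
Local Open Scope ring_scope.

Section Defs.
Variables (R : realType) (N : nat).
Notation V := 'rV[R]_N.

Definition evec (i : 'I_N) : V := delta_mx 0 i.

Definition dotp (a b : V) : R := \sum_(i < N) a 0 i * b 0 i.
Definition enorm (a : V) : R := Num.sqrt (dotp a a).

Definition partial (i : 'I_N) (f : V -> R) : V -> R := fun x => 'D_(evec i) f x.
Definition grad (f : V -> R) (x : V) : V := \row_(i < N) partial i f x.
Definition laplacian (f : V -> R) (x : V) : R := \sum_(i < N) partial i (partial i f) x.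

Fixpoint Ck (k : nat) (U : set V) (f : V -> R) : Prop :=
  match k with
  | 0 => forall x, U x -> {for x, continuous f}
  | k'.+1 => (forall x, U x -> differentiable f x) /\
             (forall i : 'I_N, Ck k' U (partial i f))
  end.

Definition harmonic_on (U : set V) (p : V -> R) : Prop :=
  Ck 2 U p /\ forall x, U x -> laplacian p x = 0.

Definition bounded_domain (Omega : set V) : Prop :=
  [/\ Omega !=set0, open Omega, connected Omega & bounded_set Omega].

Definition bdry (Omega : set V) : set V := closure Omega `\` Omega.

Definition C3_boundary (Omega : set V) : Prop :=
  forall x0, bdry Omega x0 ->
    exists (U : set V) (phi : V -> R),
      [/\ open U, U x0, Ck 3 U phi,
          (forall x, U x -> grad phi x != 0) &
          (forall x, U x -> (Omega x <-> phi x < 0))].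

Definition distG (Omega : set V) (x : V) : R :=
  inf [set enorm (x - y) | y in bdry Omega].
Definition strip (Omega : set V) (s : R) : set V :=
  [set x | Omega x /\ distG Omega x < s].

(* extension of the outward normal: n = - grad Phi *)
Definition nvec (Omega : set V) (x : V) : V := - grad (distG Omega) x.

Definition const_on_components (U : set V) (p0 : V -> R) : Prop :=
  forall x y, U x -> connected_component U x y -> p0 x = p0 y.

(* Lebesgue integral over R^N of a nonnegative function, computed as the
   iterated one-dimensional Lebesgue integral over the coordinates *)
Definition upd (x : V) (k : nat) (t : R) : V :=
  \row_(j < N) (if nat_of_ord j == k then t else x 0 j).
Fixpoint iint (k : nat) (g : V -> \bar R) : V -> \bar R :=
  match k with
  | 0 => g
  | k'.+1 => fun x => (\int[@lebesgue_measure R]_t iint k' g (upd x k' t))%E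
  end.
Definition integral_RN (g : V -> \bar R) : \bar R := iint N g 0.

Definition integral_on (U : set V) (f : V -> R) : \bar R :=
  integral_RN (fun x => if `[< U x >] then (f x)%:E else 0%E).

End Defs.

(* Main.v *)
(* Write Phi for the distance to the boundary, q = p - p0, F = H(Phi) grad Phi, and
   let p_n and p_t be the normal and tangential parts of grad p. Since p is harmonic,
   the divergence of 2 (F . grad p) grad p - |grad p|^2 F (Rellich) is
   H' (p_n^2 - p_t^2) up to terms bounded by |H| |D^2 Phi| |grad p|^2, and that of
   f(Phi) q grad p - (q^2 / 2) f'(Phi) grad Phi is f (p_n^2 + p_t^2) - (q^2 / 2) f''
   up to (q^2 / 2) f' |Lap Phi|. For H and f supported in [a, b] inside (0, s) both
   fields extend by zero, so with H' = eta - c f the difference of the two identities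
   bounds the integral of eta p_t^2 by that of eta p_n^2 + (q^2 / 2) f''. On the unit
   interval f(t) = 140 (t (1 - t))^3 has integral 1 and f'' <= 42, leaving room
   below the constant 2 * 24, and eta = 1 - (1 - 2t)^(2k) tends to 1.

   The Hessian of Phi is bounded near the boundary because a C^3 boundary admits
   interior and exterior touching balls of a uniform radius rho: they trap Phi
   between the functions rho - |x - z2| and |x - z1| - rho, which agree with Phi at
   the given point. *)
Require Import Defs.
From HB Require Import structures.
From mathcomp Require Import all_boot all_order all_algebra.
From mathcomp Require Import all_classical all_reals all_analysis.
From mathcomp Require Import ring lra.
Import Order.TTheory GRing.Theory Num.Theory.
Import numFieldNormedType.Exports.
Local Open Scope classical_set_scope.
Local Open Scope ring_scope.
Set Implicit Arguments. Unset Strict Implicit. Unset Printing Implicit Defensive.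

(** * Iterated integrals of compactly supported functions *)

(** No behaviour of p is prescribed near either end of the strip, and every integral may be
    infinite. The fields are therefore cut off away from both ends, integrated as continuous
    compactly supported functions, and the inequality is carried to the limit by monotone
    convergence. Since the integral is an iterated one-dimensional one, the divergence theorem
    reduces to this: a partial derivative of a compactly supported function integrates to zero,
    which is checked one coordinate at a time. The number c is the integral of eta, which is what
    makes H vanish at both ends. As c <= 1, the sum f (p_n^2 + p_t^2) + H' (p_t^2 - p_n^2) exceeds
    eta (p_t^2 - p_n^2) by two nonnegative terms. The Hessian error carries the factor H and is
    absorbed because |H| is at most a multiple of eta, even where eta tends to 0. On an interval of
    length at least 19 s / 20, the bound f'' <= 42 costs at most 21 (20/19)^2 / s^2, about 23.27 /
    s^2; the Laplacian term adds less than 0.57 / s^2. This is how 24 is reached. *)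

Section Coordinates.
Context {R : realType} {N : nat}.
Implicit Types (x y : 'rV[R]_N) (f g : 'rV[R]_N -> R) (j : 'I_N) (s t d e h M : R).

Lemma rv_norm_lt x d : 0 < d -> (forall j, `|x 0 j| < d) -> `|x| < d.
Proof.
move=> d0 H; rewrite [`|x|]/Num.norm /= mx_normrE.
by apply/bigmax_ltP; split => // -[a b] _ /=; rewrite (ord1 a); exact: H.
Qed.

Lemma coord_le_norm x j : `|x 0 j| <= `|x|.
Proof.
rewrite [leRHS]/Num.norm /= mx_normrE.
by apply: (le_bigmax _ (fun ij : 'I_1 * 'I_N => `|x ij.1 ij.2|) (0, j)).
Qed.

Lemma updE x k t j : upd x k t 0 j = if nat_of_ord j == k then t else x 0 j.
Proof. by rewrite mxE. Qed.

Lemma upd_sub_lt x y k s t d : 0 < d -> `|x - y| < d -> `|s - t| < d ->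
  `|upd x k s - upd y k t| < d.
Proof.
move=> d0 xy st; apply: rv_norm_lt => // j; rewrite !mxE.
case: ifP => // _; apply: le_lt_trans xy.
by have := coord_le_norm (x - y) j; rewrite !mxE.
Qed.

Lemma upd_shift x (i : 'I_N) (k : nat) h t : k != i ->
  upd (x + h *: evec R i) k t = upd x k t + h *: evec R i.
Proof.
move=> ki; apply/rowP => j; rewrite !mxE /=.
case: ifP => // /eqP jk; case: eqP => [ji|_]; last by rewrite mulr0 addr0.
by move: ki; rewrite -jk ji eqxx.
Qed.

Lemma upd_diag x (i : 'I_N) t h : upd x i (t + h) = upd x i t + h *: evec R i.
Proof.
apply/rowP => j; rewrite !mxE /= -val_eqE /=.
by case: eqP => _; rewrite ?mulr1 ?mulr0 ?addr0.
Qed.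

(** Uniform rather than pointwise continuity: a single modulus for all points is what survives
    integration over one coordinate, in [Ctail_slice]. *)
Definition ucont f := forall e, 0 < e ->
  exists2 d, 0 < d & forall x y, `|x - y| < d -> `|f x - f y| < e.

Definition tail_supp k (M : R) f :=
  forall x, (exists j : 'I_N, (k <= j)%N /\ M < `|x 0 j|) -> f x = 0.

(* [Ctail 0] is the class of continuous compactly supported functions; it is
   relaxed for [k > 0] because integrating out the first [k] coordinates leaves
   a function that no longer depends on them. *)
Definition Ctail k f := ucont f /\ exists2 M, 0 < M & tail_supp k M f.

Lemma tail_suppW k M M' f : M <= M' -> tail_supp k M f -> tail_supp k M' f.
Proof.
by move=> MM' H x [j [kj Mx]]; apply: H; exists j; split => //; apply: le_lt_trans Mx.
Qed.

Lemma CtailD k f g : Ctail k f -> Ctail k g -> Ctail k (fun x => f x + g x).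
Proof.
move=> [uf [M M0 sf]] [ug [M' M'0 sg]]; split.
  move=> e e0; have e20 : 0 < e / 2 by rewrite divr_gt0.
  have [d d0 df] := uf _ e20; have [d' d'0 dg] := ug _ e20.
  exists (Num.min d d'); first by rewrite lt_min d0.
  move=> x y; rewrite lt_min => /andP[/df xf /dg xg].
  rewrite opprD addrACA (splitr e); apply: le_lt_trans (ler_normD _ _) _.
  exact: ltrD.
exists (Num.max M M'); first by rewrite lt_max M0.
move=> x H.
have MM : M <= Num.max M M' by rewrite le_max lexx.
have MM' : M' <= Num.max M M' by rewrite le_max lexx orbT.
by rewrite (tail_suppW MM sf) // (tail_suppW MM' sg) // addr0.
Qed.

Lemma CtailZ k (a : R) f : Ctail k f -> Ctail k (fun x => a * f x).
Proof.
move=> [uf [M M0 sf]]; split; last first.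
  by exists M => // x H; rewrite sf // mulr0.
move=> e e0; have a0 : 0 < `|a| + 1 by rewrite ltr_wpDl.
have [d d0 df] := uf _ (divr_gt0 e0 a0).
exists d => // x y /df; rewrite ltr_pdivlMr // -mulrBr normrM.
apply: le_lt_trans; rewrite mulrC ler_wpM2l //.
by rewrite lerDl.
Qed.

Lemma Ctail_cst0 k : Ctail k (fun _ => 0).
Proof.
split; last by exists 1.
by move=> e e0; exists 1 => // x y _; rewrite subrr normr0.
Qed.

Lemma Ctail_sum (I : Type) (r : seq I) k (F : I -> 'rV[R]_N -> R) :
  (forall i, Ctail k (F i)) -> Ctail k (fun x => \sum_(i <- r) F i x).
Proof.
move=> H; elim: r => [|i r IH].
  rewrite (_ : (fun x => _) = (fun _ => 0)); first exact: Ctail_cst0.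
  by apply/funext => x; rewrite big_nil.
rewrite (_ : (fun x => _) = (fun x => F i x + \sum_(i <- r) F i x)).
  exact: CtailD.
by apply/funext => x; rewrite big_cons.
Qed.

End Coordinates.

(** * Integrals of compactly supported functions on the line *)

Section Slices.
Context {R : realType}.
Notation mu := (@lebesgue_measure R).
Implicit Types (f g : R -> R) (t c M : R).

Lemma integral_supp f M : (forall t, M < `|t| -> f t = 0) ->
  (\int[mu]_t (f t)%:E = \int[mu]_(t in `[(- M)%R, M]) (f t)%:E)%E.
Proof.
move=> sf; rewrite [RHS]integral_mkcond; apply: eq_integral => t _.
rewrite patchE; case: ifPn => // /negP; rewrite inE /= in_itv /= => tM.
by rewrite sf // ltNge ler_norml; apply/negP.
Qed.

Lemma Rintegral_supp f M : (forall t, M < `|t| -> f t = 0) ->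
  (\int[mu]_t f t = \int[mu]_(t in `[- M, M]) f t)%R.
Proof. by move=> sf; rewrite /Rintegral (integral_supp sf). Qed.

Lemma integrable_supp f M : continuous f -> (forall t, M < `|t| -> f t = 0) ->
  mu.-integrable setT (EFin \o f).
Proof.
move=> cf sf.
have I : mu.-integrable `[- M, M] (EFin \o f).
  apply: continuous_compact_integrable; first exact: segment_compact.
  exact: continuous_subspaceT.
move: I; rewrite integrable_mkcond //.
apply: eq_integrable => // t _; rewrite patchE; case: ifPn => // /negP.
rewrite inE /= in_itv /= => tM.
by rewrite sf // ltNge ler_norml; apply/negP.
Qed.

Lemma Rintegral_supp_le f M c : 0 < M -> continuous f ->
  (forall t, M < `|t| -> f t = 0) -> (forall t, `|f t| <= c) ->
  `|\int[mu]_t f t| <= c * (M + M).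
Proof.
move=> M0 cf sf fc; rewrite (Rintegral_supp sf).
have I : mu.-integrable `[- M, M] (EFin \o f).
  apply: continuous_compact_integrable; first exact: segment_compact.
  exact: continuous_subspaceT.
apply: le_trans (le_normr_Rintegral _ I) _ => //.
have -> : c * (M + M) = (\int[mu]_(t in `[- M, M]) c).
  rewrite Rintegral_cst //= lebesgue_measure_itv /= lte_fin.
  by rewrite ifT ?opprK //; lra.
apply: le_Rintegral => //.
  apply: continuous_compact_integrable; first exact: segment_compact.
  apply: continuous_subspaceT => t; apply: continuous_comp; first exact: cf.
  exact: norm_continuous.
apply: continuous_compact_integrable; first exact: segment_compact.
by apply: continuous_subspaceT => t; exact: cst_continuous.
Qed.

Lemma is_derive_dist f (t l : R) :
  (forall e : R, 0 < e -> exists2 d : R, 0 < d &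
    forall h : R, `|h| < d -> `|f (t + h) - f t - h * l| <= e * `|h|) ->
  is_derive t (1 : R) f l.
Proof.
move=> H.
have L : h^-1 *: (f (h *: (1 : R) + t) - f t) @[h --> 0^'] --> l.
  apply/cvgrPdist_le => e e0; have [d d0 {}H] := H e e0.
  near=> h.
  have h0 : h != 0 by near: h; exact: nbhs_dnbhs_neq.
  have hd : `|h| < d by near: h; exact: dnbhs0_lt.
  rewrite /GRing.scale /= mulr1 (addrC h t).
  have -> : l - h^-1 * (f (t + h) - f t) = - (h^-1 * (f (t + h) - f t - h * l)).
    by rewrite [in RHS]mulrBr mulKf // opprB.
  by rewrite normrN normrM normfV ler_pdivrMl ?normr_gt0 // [leRHS]mulrC; exact: H.
apply: DeriveDef; first by apply/cvg_ex; exists l.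
exact: cvg_lim L.
Unshelve. all: by end_near. Qed.

Lemma Rintegral_deriv_supp f g M : 0 < M -> continuous g ->
  (forall t, is_derive t (1 : R) f (g t)) ->
  (forall t, M < `|t| -> f t = 0) -> (forall t, M < `|t| -> g t = 0) ->
  \int[mu]_t g t = 0.
Proof.
move=> M0 cg df sf sg.
have cf : continuous f.
  by move=> t; apply/differentiable_continuous/derivable1_diffP; have [] := df t.
(* The support hypotheses say nothing at distance exactly [M]; integrating over the interval of
   radius [M + 1] makes both endpoint values of [f] zero. *)
have sg' t : M + 1 < `|t| -> g t = 0.
  by move=> h; apply: sg; apply: lt_trans h; rewrite ltrDl.
rewrite /Rintegral (integral_supp sg') (@continuous_FTC2 _ _ f) //.
- have M1 : M < `|M + 1| by rewrite gtr0_norm; lra.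
  have M2 : M < `|- (M + 1)| by rewrite normrN.
  by rewrite (sf _ M1) (sf _ M2) /= subr0.
- by lra.
- exact: continuous_subspaceT.
- split.
  + by move=> t _; have [] := df t.
  + apply: cvg_at_right_filter; exact: cf.
  + apply: cvg_at_left_filter; exact: cf.
- by move=> t _; rewrite derive1E; have [_ ->] := df t.
Qed.

End Slices.

(** * Integration coordinate by coordinate, and integrals of partial derivatives *)

Section IteratedIntegral.
Context {R : realType} {N : nat}.
Notation mu := (@lebesgue_measure R).
Notation V := 'rV[R]_N.
Implicit Types (f g : V -> R) (x : V) (t c M a e h : R).

Definition slice_int (k : nat) f : V -> R := fun x => \int[mu]_t f (upd x k t).

(** Real-valued counterpart of [iint], linear on [Ctail 0] integrands; [iint_monotone] links the
    two. *)
Fixpoint rint (k : nat) f : V -> R :=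
  if k is k'.+1 then slice_int k' (rint k' f) else f.

Section Slice.
Variables (k : nat) (kN : (k < N)%N).

Lemma slice_cont f x : ucont f -> continuous (fun t => f (upd x k t)).
Proof.
move=> uf t; apply/cvgrPdist_lt => e e0.
have [d d0 H] := uf e e0.
apply/nbhs_ballP; exists d => //= s ts; apply: H; apply: upd_sub_lt => //.
by rewrite subrr normr0.
Qed.

Lemma slice_supp f x M : tail_supp k M f ->
  forall t, M < `|t| -> f (upd x k t) = 0.
Proof.
by move=> sf t Mt; apply: sf; exists (Ordinal kN) => /=; rewrite updE /= eqxx.
Qed.

Lemma slice_integrable f x : Ctail k f ->
  mu.-integrable setT (EFin \o (fun t => f (upd x k t))).
Proof.
move=> [uf [M M0 sf]]; apply: integrable_supp; first exact: slice_cont.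
exact: slice_supp sf.
Qed.

Lemma slice_intD f g : Ctail k f -> Ctail k g ->
  slice_int k (fun x => f x + g x) = (fun x => slice_int k f x + slice_int k g x).
Proof.
move=> cf cg; apply/funext => x; rewrite /slice_int.
by rewrite RintegralD //; exact: slice_integrable.
Qed.

Lemma slice_intZ f a : Ctail k f ->
  slice_int k (fun x => a * f x) = (fun x => a * slice_int k f x).
Proof.
move=> cf; apply/funext => x; rewrite /slice_int.
by rewrite RintegralZl //; exact: slice_integrable.
Qed.

Lemma slice_int_le f g : Ctail k f -> Ctail k g -> (forall x, f x <= g x) ->
  forall x, slice_int k f x <= slice_int k g x.
Proof.
move=> cf cg fg x; apply: le_Rintegral => //; exact: slice_integrable.
Qed.

Lemma slice_intB f g x y : Ctail k f -> Ctail k g ->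
  slice_int k f x - slice_int k g y = \int[mu]_t (f (upd x k t) - g (upd y k t)).
Proof.
by move=> cf cg; rewrite /slice_int RintegralB //; exact: slice_integrable.
Qed.

(** In coordinate [k] the integrand lives on an interval of length [M + M], so a variation below
    [e / 2 / (M + M)] integrates to at most [e / 2]; the extra half restores the strict
    inequality. *)
Lemma Ctail_slice f : Ctail k f -> Ctail k.+1 (slice_int k f).
Proof.
move=> cf; have [uf [M M0 sf]] := cf; split; last first.
  exists M => // x [j [kj Mx]]; rewrite /slice_int.
  rewrite (@eq_Rintegral _ _ _ _ _ (fun _ => 0)) ?Rintegral_cst ?mul0r //.
  move=> t _; apply: sf; exists j; split; first exact: ltnW.
  by rewrite updE gtn_eqF.
move=> e e0; have M20 : 0 < M + M by rewrite addr_gt0.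
have [d d0 H] := uf (e / 2 / (M + M)) (divr_gt0 (divr_gt0 e0 (ltr0Sn R 1)) M20).
exists d => // x y xy; rewrite slice_intB //.
have hd t : `|upd x k t - upd y k t| < d.
  by apply: upd_sub_lt => //; rewrite subrr normr0.
have : `|\int[mu]_t (f (upd x k t) - f (upd y k t))| <= e / 2 / (M + M) * (M + M).
  apply: Rintegral_supp_le => //.
  - by move=> t; apply: cvgB; exact: slice_cont.
  - by move=> t Mt; rewrite !(slice_supp _ sf) // subrr.
  - by move=> t; apply/ltW/H.
rewrite divfK ?gt_eqF // => /le_lt_trans; apply.
by rewrite ltr_pdivrMr // ltr_pMr // ltr1n.
Qed.

End Slice.

Lemma Ctail_rint k f : (k <= N)%N -> Ctail 0 f -> Ctail k (rint k f).
Proof.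
by elim: k => // k IH kN cf; apply: Ctail_slice => //; apply: IH => //; exact: ltnW.
Qed.

Lemma rintD k f g : (k <= N)%N -> Ctail 0 f -> Ctail 0 g ->
  rint k (fun x => f x + g x) = (fun x => rint k f x + rint k g x).
Proof.
elim: k => // k IH kN cf cg /=; rewrite IH ?slice_intD //; try exact: ltnW.
  by apply/Ctail_rint/cf/ltnW.
by apply/Ctail_rint/cg/ltnW.
Qed.

Lemma rintZ k f a : (k <= N)%N -> Ctail 0 f ->
  rint k (fun x => a * f x) = (fun x => a * rint k f x).
Proof.
elim: k => // k IH kN cf /=; rewrite IH ?slice_intZ //; try exact: ltnW.
by apply/Ctail_rint/cf/ltnW.
Qed.

Lemma rint_cst0 k : rint k (fun _ => 0) = (fun _ => 0).
Proof.
elim: k => // k IH /=; rewrite IH; apply/funext => x.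
by rewrite /slice_int Rintegral_cst // mul0r.
Qed.

Lemma rint_sum (I : Type) (r : seq I) k (F : I -> V -> R) : (k <= N)%N ->
  (forall i, Ctail 0 (F i)) ->
  rint k (fun x => \sum_(i <- r) F i x) = (fun x => \sum_(i <- r) rint k (F i) x).
Proof.
move=> kN H; elim: r => [|i r IH].
  rewrite (_ : (fun x => _) = (fun _ => 0)); last first.
    by apply/funext => x; rewrite big_nil.
  by rewrite rint_cst0; apply/funext => x; rewrite big_nil.
rewrite (_ : (fun x => _) = (fun x => F i x + \sum_(i <- r) F i x)); last first.
  by apply/funext => x; rewrite big_cons.
rewrite rintD //; last exact: Ctail_sum.
by rewrite IH; apply/funext => x; rewrite big_cons.
Qed.

Lemma rint_le k f g : (k <= N)%N -> Ctail 0 f -> Ctail 0 g ->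
  (forall x, f x <= g x) -> forall x, rint k f x <= rint k g x.
Proof.
elim: k => // k IH kN cf cg fg /=; apply: slice_int_le => //.
- by apply/Ctail_rint/cf/ltnW.
- by apply/Ctail_rint/cg/ltnW.
- by apply: IH => //; exact: ltnW.
Qed.

Lemma rint_ge0 k f : (k <= N)%N -> Ctail 0 f ->
  (forall x, 0 <= f x) -> forall x, 0 <= rint k f x.
Proof.
move=> kN cf f0 x.
by have := rint_le kN (Ctail_cst0 0) cf f0 x; rewrite rint_cst0.
Qed.

(** Partial derivative whose remainder is uniform in the base point. Such a bound passes directly
    under an integral over a bounded range, so differentiation under the integral sign calls for no
    dominated convergence. *)
Definition uderiv (i : 'I_N) f g := forall e, 0 < e -> exists2 d, 0 < d &
  forall x h, `|h| < d -> `|f (x + h *: evec R i) - f x - h * g x| <= e * `|h|.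

Lemma uderiv_slice k (i : 'I_N) f g : (k < i)%N -> Ctail k f -> Ctail k g ->
  uderiv i f g -> uderiv i (slice_int k f) (slice_int k g).
Proof.
move=> ki cf cg dfg e e0.
have kN : (k < N)%N by apply: ltn_trans ki _.
have [uf [M M0 sf]] := cf; have [ug [M' M'0 sg]] := cg.
set L := Num.max M M'.
have L0 : 0 < L by rewrite lt_max M0.
have L20 : 0 < L + L by rewrite addr_gt0.
have [d d0 H] := dfg (e / (L + L)) (divr_gt0 e0 L20).
exists d => // x h hd.
have {}sf : tail_supp k L f by apply: tail_suppW sf; rewrite le_max lexx.
have {}sg : tail_supp k L g by apply: tail_suppW sg; rewrite le_max lexx orbT.
have ih y : mu.-integrable setT (EFin \o (fun t => f (upd y k t))).
  exact: slice_integrable.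
have -> : slice_int k f (x + h *: evec R i) - slice_int k f x - h * slice_int k g x =
   \int[mu]_t (f (upd x k t + h *: evec R i) - f (upd x k t) - h * g (upd x k t)).
  rewrite RintegralB //; last 2 first.
  - have := integrableB measurableT (ih (x + h *: evec R i)) (ih x).
    apply: eq_integrable => // t _ /=.
    by rewrite upd_shift // ltn_eqF.
  - exact: slice_integrable (CtailZ h cg).
  rewrite RintegralZl //; last exact: slice_integrable.
  congr (_ - _).
  rewrite slice_intB //; apply: eq_Rintegral => t _.
  by rewrite upd_shift // ltn_eqF.
rewrite -[e in leRHS](@divfK _ (L + L)) ?gt_eqF // mulrAC.
apply: Rintegral_supp_le => //.
- move=> t; apply: cvgB; last by apply: cvgM; [exact: cvg_cst|exact: slice_cont].
  apply: cvgB; last exact: slice_cont.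
  under eq_cvg do rewrite -upd_shift ?ltn_eqF //.
  rewrite -upd_shift ?ltn_eqF //.
  exact: slice_cont.
- move=> t Lt; rewrite -upd_shift ?ltn_eqF //.
  by rewrite !(slice_supp kN _ sf) // (slice_supp kN _ sg) // mulr0 !subrr.
- by move=> t; exact: H.
Qed.

Lemma slice_int_uderiv (i : 'I_N) f g x : Ctail i f -> Ctail i g ->
  uderiv i f g -> slice_int i g x = 0.
Proof.
move=> [uf [M M0 sf]] [ug [M' M'0 sg]] dfg.
set L := Num.max M M'.
have L0 : 0 < L by rewrite lt_max M0.
have {}sf : tail_supp i L f by apply: tail_suppW sf; rewrite le_max lexx.
have {}sg : tail_supp i L g by apply: tail_suppW sg; rewrite le_max lexx orbT.
apply: (@Rintegral_deriv_supp _ (fun t => f (upd x i t)) _ L) => //.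
- exact: slice_cont.
- move=> t; apply: is_derive_dist => e e0; have [d d0 H] := dfg e e0.
  by exists d => // h hd; rewrite upd_diag; exact: H.
- exact: slice_supp.
- exact: slice_supp.
Qed.

(** The relation [uderiv i] persists while the coordinates below [i] are integrated out; the
    integral over coordinate [i] is then zero by the fundamental theorem of calculus, and the later
    integrals are those of the zero function. The order of integration is never changed. *)
Lemma rint_uderiv (i : 'I_N) f g x : Ctail 0 f -> Ctail 0 g -> uderiv i f g ->
  rint N g x = 0.
Proof.
move=> cf cg dfg.
have D k : (k <= i)%N -> uderiv i (rint k f) (rint k g).
  elim: k => // k IH ki; apply: uderiv_slice => //.
  - apply: Ctail_rint => //; apply: leq_trans (ltnW ki) (ltnW (ltn_ord i)).
  - apply: Ctail_rint => //; apply: leq_trans (ltnW ki) (ltnW (ltn_ord i)).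
  - exact/IH/ltnW.
have Z k : (i < k)%N -> rint k g = (fun _ => 0).
  elim: k => // k IH; rewrite ltnS leq_eqVlt => /orP[/eqP <-|ik].
    apply/funext => y; apply: slice_int_uderiv (D _ (leqnn i)).
      by apply: Ctail_rint => //; exact: ltnW.
    by apply: Ctail_rint => //; exact: ltnW.
  by rewrite /= (IH ik); apply/funext => y; rewrite /slice_int Rintegral_cst ?mul0r.
by rewrite Z.
Qed.

(** Monotone convergence applied in one coordinate after another; the measurability it demands is
    that of the continuous slices [rint k (f n)]. *)
Lemma iint_monotone k (f : nat -> V -> R) (g : V -> \bar R) : (k <= N)%N ->
  (forall n, Ctail 0 (f n)) -> (forall n x, 0 <= f n x) ->
  (forall x, {homo (fun n => f n x) : m n / (m <= n)%N >-> m <= n}) ->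
  (forall x, (f n x)%:E @[n --> \oo] --> g x) ->
  forall x, (rint k (f n) x)%:E @[n --> \oo] --> iint k g x.
Proof.
move=> + cf f0 ndf fg; elim: k => // k IH kN x /=.
pose F n t := (rint k (f n) (upd x k t))%:E.
rewrite (_ : (fun n => _) = (fun n => \int[mu]_t F n t)%E); last first.
  apply/funext => n; rewrite /slice_int /Rintegral fineK //.
  by apply: integrable_fin_num => //; apply/slice_integrable/Ctail_rint/cf/ltnW.
rewrite (_ : (\int[mu]_t _)%E = (\int[mu]_t limn (F^~ t))%E); last first.
  apply: eq_integral => t _; apply/esym/cvg_lim => //.
  exact: IH (ltnW kN) _.
apply: cvg_monotone_convergence => //.
- move=> n; apply: (measurable_int mu).
  by apply/slice_integrable/Ctail_rint/cf/ltnW.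
- by move=> n t _; rewrite lee_fin; apply: rint_ge0 => //; exact: ltnW.
- move=> t _ m n mn; rewrite lee_fin; apply: rint_le => //; first exact: ltnW.
  by move=> y; exact: ndf.
Qed.

End IteratedIntegral.

(** * Directional derivatives *)

Section Pointwise.
Context {R : realType}.
Implicit Types (a b : R).

Lemma is_deriveDf (W : normedModType R) (f g : W -> R) (x v : W) a b :
  is_derive x v f a -> is_derive x v g b ->
  is_derive x v (fun y => f y + g y) (a + b).
Proof. by move=> H1 H2; exact: is_deriveD. Qed.

Lemma is_deriveBf (W : normedModType R) (f g : W -> R) (x v : W) a b :
  is_derive x v f a -> is_derive x v g b ->
  is_derive x v (fun y => f y - g y) (a - b).
Proof. by move=> H1 H2; exact: is_deriveB. Qed.

Lemma is_deriveMf (W : normedModType R) (f g : W -> R) (x v : W) a b :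
  is_derive x v f a -> is_derive x v g b ->
  is_derive x v (fun y => f y * g y) (f x * b + g x * a).
Proof.
by move=> H1 H2; have := @is_deriveM _ _ f g x v a b H1 H2.
Qed.

Lemma is_derive_cstM (W : normedModType R) (f : W -> R) (x v : W) a b : is_derive x v f a ->
  is_derive x v (fun y => b * f y) (b * a).
Proof.
move=> H1; have := @is_deriveMf _ (cst b) f x v _ _ (is_derive_cst b x v) H1.
by move=> H; apply: (is_derive_eq H); rewrite /cst mulr0 addr0.
Qed.

Lemma is_derive_sumf (I : Type) (r : seq I) (W : normedModType R) (F : I -> W -> R)
    (dF : I -> R) (x v : W) :
  (forall k, is_derive x v (F k) (dF k)) ->
  is_derive x v (fun y => \sum_(k <- r) F k y) (\sum_(k <- r) dF k).
Proof.
move=> H; elim: r => [|i r IH].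
  rewrite (_ : (fun y => _) = cst 0) ?big_nil; first exact: is_derive_cst.
  by apply/funext => y; rewrite big_nil.
rewrite (_ : (fun y => _) = (fun y => F i y + \sum_(k <- r) F k y)) ?big_cons.
  exact: is_deriveDf.
by apply/funext => y; rewrite big_cons.
Qed.

Lemma is_derive_expf (W : normedModType R) (f : W -> R) (x v : W) a n :
  is_derive x v f a -> is_derive x v (fun y => f y ^+ n.+1) (n.+1%:R * f x ^+ n * a).
Proof.
move=> df; elim: n => [|n IH].
  rewrite (_ : (fun y => _) = f); last by apply/funext => y; rewrite expr1.
  by apply: (is_derive_eq df); rewrite expr0 !mul1r.
rewrite (_ : (fun y => _) = (fun y => f y * f y ^+ n.+1)); last first.
  by apply/funext => y; rewrite exprS.
apply: (is_derive_eq (is_deriveMf df IH)).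
by rewrite -[n.+2]addn1 natrD exprS; ring.
Qed.

Lemma cont_add (W : topologicalType) (f g : W -> R) (x : W) :
  {for x, continuous f} -> {for x, continuous g} ->
  {for x, continuous (fun y => f y + g y)}.
Proof. by move=> cf cg; exact: (cvgD cf cg). Qed.

Lemma cont_sub (W : topologicalType) (f g : W -> R) (x : W) :
  {for x, continuous f} -> {for x, continuous g} ->
  {for x, continuous (fun y => f y - g y)}.
Proof. by move=> cf cg; exact: (cvgB cf cg). Qed.

Lemma cont_mul (W : topologicalType) (f g : W -> R) (x : W) :
  {for x, continuous f} -> {for x, continuous g} ->
  {for x, continuous (fun y => f y * g y)}.
Proof. by move=> cf cg; exact: (cvgM cf cg). Qed.

Lemma cont_exp (W : topologicalType) (f : W -> R) (x : W) n :
  {for x, continuous f} -> {for x, continuous (fun y => f y ^+ n)}.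
Proof.
move=> cf; elim: n => [|n IH].
  by apply: (@cst_continuous W R 1 x).
rewrite (_ : (fun y => _) = (fun y => f y * f y ^+ n)); first exact: cont_mul.
by apply/funext => y; rewrite exprS.
Qed.

Lemma cont_sum (W : topologicalType) (I : Type) (r : seq I) (F : I -> W -> R) (x : W) :
  (forall k, {for x, continuous (F k)}) ->
  {for x, continuous (fun y => \sum_(k <- r) F k y)}.
Proof.
move=> H; elim: r => [|k r IH].
  rewrite (_ : (fun y => _) = cst 0); first exact: (@cst_continuous W R 0 x).
  by apply/funext => y; rewrite big_nil.
rewrite (_ : (fun y => _) = (fun y => F k y + \sum_(k <- r) F k y)).
  exact: cont_add.
by apply/funext => y; rewrite big_cons.
Qed.

End Pointwise.

Section DirectionalDerivatives.
Context {R : realType} {N : nat}.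
Notation V := 'rV[R]_N.
Implicit Types (f g : V -> R) (x y v : V) (t c a e h d : R) (i j : 'I_N).

Lemma is_derive_line (W : normedModType R) (f : W -> R) (x v : W) t df :
  is_derive (x + t *: v) v f df ->
  is_derive t (1 : R) (fun s : R => f (x + s *: v)) df.
Proof.
move=> [df1 df2].
have E : (fun h : R => h^-1 *: (((fun s : R => f (x + s *: v)) \o shift t) (h *: (1 : R))
      - f (x + t *: v)))
   = (fun h : R => h^-1 *: ((f \o shift (x + t *: v)) (h *: v) - f (x + t *: v))).
  apply/funext => h /=; congr (_ *: (f _ - _)).
  by rewrite [_%:A]mulr1 scalerDl addrCA.
apply: DeriveDef; first by move: df1; rewrite /derivable E.
by rewrite -df2 /derive E.
Qed.

Lemma MVT_line f v x h : 0 < h ->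
  (forall t, 0 <= t <= h -> derivable f (x + t *: v) v) ->
  exists2 c, 0 < c < h & f (x + h *: v) - f x = h * 'D_v f (x + c *: v).
Proof.
move=> h0 df.
have D t : 0 <= t <= h ->
    is_derive t (1 : R) (fun s : R => f (x + s *: v)) ('D_v f (x + t *: v)).
  by move=> th; apply/is_derive_line/derivableP/df.
have [||c ch E] := @MVT R (fun s => f (x + s *: v)) (fun s => 'D_v f (x + s *: v)) 0 h h0.
- by move=> t; rewrite in_itv /= => /andP[/ltW t0 /ltW th]; apply: D; rewrite t0.
- apply: derivable_within_continuous => t; rewrite in_itv /= => th.
  by have [] := D t th.
exists c; first by rewrite in_itv /= in ch.
by move: E; rewrite scale0r addr0 subr0 mulrC.
Qed.

Lemma is_derive_compf (W : normedModType R) (F : R -> R) (f : W -> R) (x v : W) a b :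
  {for x, continuous f} ->
  is_derive (f x) (1 : R) F a -> is_derive x v f b ->
  is_derive x v (fun y : W => F (f y)) (a * b).
Proof.
move=> cf dF df.
have H1 : is_derive (0 : R) (1 : R) (fun s : R => f (x + s *: v)) b.
  by apply: is_derive_line; rewrite scale0r addr0.
have H2 : is_derive (0 : R) (1 : R) (F \o (fun s : R => f (x + s *: v))) (a * b).
  have [d1 d2] := H1; have [d3 d4] := dF.
  have E : f (x + 0 *: v) = f x by rewrite scale0r addr0.
  have dd1 : derivable F (f (x + 0 *: v)) 1 by rewrite E.
  apply: DeriveDef.
    exact/derivable1_diffP/(differentiable_comp ((derivable1_diffP _ _).1 d1) ((derivable1_diffP _ _).1 dd1)).
  rewrite -derive1E (derive1_comp d1 dd1).
  by rewrite !derive1E E d4 d2.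
have [d1 d2] := H2.
have E : (fun h : R => h^-1 *: (((F \o (fun s : R => f (x + s *: v))) \o shift 0) (h *: (1 : R))
      - (F \o (fun s : R => f (x + s *: v))) 0))
   = (fun h : R => h^-1 *: (((fun y : W => F (f y)) \o shift x) (h *: v) - F (f x))).
  apply/funext => h /=; rewrite [_%:A]mulr1 addr0 scale0r addr0.
  by rewrite (addrC x).
apply: DeriveDef; first by move: d1; rewrite /derivable E.
by rewrite -d2 /derive E.
Qed.

Lemma derive_lincomb f x v : differentiable f x ->
  'D_v f x = \sum_i v 0 i * partial i f x.
Proof.
move=> df; rewrite deriveE // [in LHS](row_sum_delta v) linear_sum /=.
apply: eq_bigr => i _; rewrite linearZ /=; congr (_ * _).
by rewrite /partial deriveE.
Qed.

Lemma nbhs_rV_ball x (U : set V) : nbhs x U ->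
  exists2 r, 0 < r & forall y, `|x - y| < r -> U y.
Proof.
move=> /nbhs_ballP [r /= r0 H]; exists r => // y xy; apply: H.
by rewrite -ball_normE.
Qed.

Lemma open_rV_ball x (U : set V) : open U -> U x ->
  exists2 r, 0 < r & forall y, `|x - y| < r -> U y.
Proof. by move=> oU Ux; apply/nbhs_rV_ball/open_nbhs_nbhs. Qed.

Lemma cont_rV_dist f x : {for x, continuous f} -> forall e, 0 < e ->
  exists2 r, 0 < r & forall y, `|x - y| < r -> `|f x - f y| < e.
Proof.
move=> cf e e0.
have H : \forall y \near x, `|f x - f y| < e by move/cvgrPdist_lt : cf; exact.
exact: nbhs_rV_ball H.
Qed.

Lemma dist_cont_rV f x : (forall e, 0 < e ->
  exists2 r, 0 < r & forall y, `|x - y| < r -> `|f x - f y| < e) -> {for x, continuous f}.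
Proof.
move=> H; apply: (iffRL (@cvgrPdist_lt _ _ _ (nbhs x) _ f (f x))) => e e0.
have [r r0 K] := H e e0.
by apply/nbhs_ballP; exists r => // y; rewrite -ball_normE; exact: K.
Qed.

Lemma evec_norm i t : `|t *: evec R i| <= `|t|.
Proof.
rewrite [leLHS]/Num.norm /= mx_normrE; apply/bigmax_leP; split => // -[a b] _ /=.
rewrite !mxE normrM; case: (_ && _); first by rewrite normr1 mulr1.
by rewrite normr0 mulr0.
Qed.

(** * Symmetry of second partial derivatives *)

Section Schwarz.
Variables (U : set V) (f : V -> R).
Hypotheses (oU : open U) (cf : Ck 2 U f).

(** The mean value theorem is used twice: in direction [i] for the increment of [f] by [h] along
    direction [j], then in direction [j] for [partial i f]. Continuity of the mixed derivative at
    [x] bounds the error. *)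
Lemma second_difference i j x : U x -> forall e, 0 < e ->
  exists2 d, 0 < d & forall h, 0 < h < d ->
   `|f (x + h *: evec R i + h *: evec R j) - f (x + h *: evec R i)
      - f (x + h *: evec R j) + f x - h * h * partial j (partial i f) x| <= e * (h * h).
Proof.
move=> Ux e e0; have [df /= dpf] := cf.
have [r r0 rU] := open_rV_ball oU Ux.
have [r' r'0 cr] := cont_rV_dist ((dpf i).2 j x Ux) e0.
exists (Num.min r r' / 2); first by rewrite divr_gt0 // lt_min r0.
move=> h /andP[h0 hd].
have hr : h + h < Num.min r r' by lra.
have near0 s t : 0 <= s <= h -> 0 <= t <= h ->
    `|x - (x + s *: evec R i + t *: evec R j)| < Num.min r r'.
  move=> /andP[s0 sh] /andP[t0 th]; rewrite -addrA opprD addNKr normrN.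
  apply: le_lt_trans (ler_normD _ _) _; apply: le_lt_trans hr.
  by apply: lerD; apply: le_trans (evec_norm _ _) _; rewrite ger0_norm.
have inU s t : 0 <= s <= h -> 0 <= t <= h -> U (x + s *: evec R i + t *: evec R j).
  by move=> sh th; apply: rU; have := near0 s t sh th; rewrite lt_min => /andP[].
have zh : (0 : R) <= (0 : R) <= h by apply/andP; split => //; exact: ltW.
have hh : (0 : R) <= h <= h by apply/andP; split => //; exact: ltW.
pose g y := f (y + h *: evec R j) - f y.
have dg t : 0 <= t <= h -> is_derive (x + t *: evec R i) (evec R i) g
   (partial i f (x + t *: evec R i + h *: evec R j) - partial i f (x + t *: evec R i)).
  move=> th; apply: is_deriveBf.
    have -> : (fun y => f (y + h *: evec R j)) = f \o shift (h *: evec R j) by [].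
    have := @derivableP _ _ _ f (x + t *: evec R i + h *: evec R j) (evec R i)
      (diff_derivable (df _ (inU _ _ th hh))).
    move=> [H1 H2].
    have E : (fun k : R => k^-1 *: (((f \o shift (h *: evec R j)) \o shift (x + t *: evec R i)) (k *: evec R i)
        - (f \o shift (h *: evec R j)) (x + t *: evec R i)))
      = (fun k : R => k^-1 *: ((f \o shift (x + t *: evec R i + h *: evec R j)) (k *: evec R i)
        - f (x + t *: evec R i + h *: evec R j))).
      by apply/funext => k /=; rewrite !addrA.
    by apply: DeriveDef; [move: H1; rewrite /derivable E|rewrite /partial /derive E].
  apply/derivableP/diff_derivable/df.
  by have := inU _ _ th zh; rewrite scale0r addr0.
have [|c ch E1] := @MVT_line g (evec R i) x h h0.
  by move=> t th; have [] := dg t th.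
have {}ch : 0 <= c <= h by case/andP: ch => /ltW -> /ltW ->.
have [|c' c'h E2] := @MVT_line (partial i f) (evec R j) (x + c *: evec R i) h h0.
  by move=> t th; apply/diff_derivable/(dpf i).1/inU.
have {}c'h : 0 <= c' <= h by case/andP: c'h => /ltW -> /ltW ->.
have -> : f (x + h *: evec R i + h *: evec R j) - f (x + h *: evec R i)
      - f (x + h *: evec R j) + f x = g (x + h *: evec R i) - g x.
  by rewrite /g opprB addrA addrAC.
rewrite E1 (derive_val (is_derive := dg c ch)) E2 mulrA -mulrBr normrM.
rewrite ger0_norm ?mulr_ge0 ?(ltW h0) // mulrC ler_wpM2r ?mulr_ge0 ?(ltW h0) //.
rewrite distrC; apply/ltW/cr.
by have := near0 _ _ ch c'h; rewrite lt_min => /andP[].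
Qed.

(** The second difference is unchanged when [i] and [j] are exchanged, so for one common small [h]
    it approximates both mixed derivatives times [h * h]. *)
Lemma partialC i j x : U x -> partial j (partial i f) x = partial i (partial j f) x.
Proof.
move=> Ux; apply/eqP; rewrite -subr_eq0 -normr_le0; apply/ler_addgt0Pr => e e0.
rewrite add0r.
have e20 : 0 < e / 2 by rewrite divr_gt0.
have [d d0 H1] := second_difference i j Ux e20.
have [d' d'0 H2] := second_difference j i Ux e20.
pose h := Num.min d d' / 2.
have h0 : 0 < h by rewrite divr_gt0 // lt_min d0.
have hd : h < d /\ h < d'.
  have : h < Num.min d d' by rewrite /h gtr_pMr ?lt_min ?d0 // invf_lt1 // ltr1n.
  by rewrite lt_min => /andP[].
have {}H1 := H1 h; have {}H2 := H2 h; rewrite h0 hd.1 in H1; rewrite h0 hd.2 in H2.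
move: (H1 isT) (H2 isT).
rewrite (_ : x + h *: evec R j + h *: evec R i = x + h *: evec R i + h *: evec R j); last first.
  by rewrite addrAC.
set A := f _; set B := f _; set C := f _; set D := f _.
set P := partial _ _ _; set Q := partial _ _ _ => K1 K2.
have hh : 0 < h * h by rewrite mulr_gt0.
rewrite -(ler_pM2r hh) -[X in `|_| * X](gtr0_norm hh) -normrM.
have -> : (P - Q) * (h * h) = (A - C - B + D - h * h * Q) - (A - B - C + D - h * h * P).
  by ring.
have -> : e * (h * h) = e / 2 * (h * h) + e / 2 * (h * h).
  by rewrite -mulrDl -splitr.
exact: le_trans (ler_normB _ _) (lerD K2 K1).
Qed.

End Schwarz.
End DirectionalDerivatives.

(** * Extension by zero of functions supported in a compact part of an open set *)

Section LocalizedFunctions.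
Context {R : realType} {N : nat}.
Notation V := 'rV[R]_N.
Implicit Types (f g : V -> R) (x y v : V) (e d : R) (i : 'I_N).

Definition zero_ext (U : set V) f : V -> R := fun x => if `[< U x >] then f x else 0.

Lemma zero_extT (U : set V) f x : U x -> zero_ext U f x = f x.
Proof. by move=> Ux; rewrite /zero_ext asboolT. Qed.

Variables (U K : set V).
Hypotheses (oU : open U) (cK : closed K) (bK : bounded_set K) (KU : K `<=` U).

Lemma zero_ext_near f x : U x -> \forall y \near x, f y = zero_ext U f y.
Proof.
move=> Ux; have := open_nbhs_nbhs (conj oU Ux).
by apply: filterS => y Uy; rewrite zero_extT.
Qed.

Lemma zero_ext_near0 f x : (forall y, U y -> ~ K y -> f y = 0) -> ~ K x ->
  \forall y \near x, cst 0 y = zero_ext U f y.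
Proof.
move=> f0 Kx.
have : nbhs x (~` K) by apply: open_nbhs_nbhs; split => //; exact: closed_openC.
apply: filterS => y Ky; rewrite /zero_ext /cst; case: asboolP => // Uy.
by rewrite f0.
Qed.

(** The open sets [U] and the complement of [K] cover the space; the extension is [f] on the first
    and zero on the second. The same splitting gives the derivative below. *)
Lemma zero_ext_cont f : (forall x, U x -> {for x, continuous f}) ->
  (forall y, U y -> ~ K y -> f y = 0) -> continuous (zero_ext U f).
Proof.
move=> cf f0; suff H (x : V) : {for x, continuous (zero_ext U f)} by move=> x; exact: H.
have [Kx|Kx] := pselect (K x).
  have Ux := KU Kx.
  rewrite /prop_for /continuous_at zero_extT //; apply: cvg_trans (cf x Ux).
  exact: near_eq_cvg (zero_ext_near f Ux).
rewrite /prop_for /continuous_at -(nbhs_singleton (zero_ext_near0 f0 Kx)).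
apply: (cvg_trans (near_eq_cvg (zero_ext_near0 f0 Kx))); exact: (@cst_continuous V R 0 x).
Qed.

Lemma zero_ext_is_derive f g v : (forall x, U x -> is_derive x v f (g x)) ->
  (forall y, U y -> ~ K y -> f y = 0) -> (forall y, U y -> ~ K y -> g y = 0) ->
  forall x, is_derive x v (zero_ext U f) (zero_ext U g x).
Proof.
move=> df f0 g0 x; have [Kx|Kx] := pselect (K x).
  rewrite (zero_extT g (KU Kx)); apply: near_eq_is_derive (df _ (KU Kx)).
  exact/zero_ext_near/KU.
rewrite -(nbhs_singleton (zero_ext_near0 g0 Kx)).
apply: near_eq_is_derive (is_derive_cst 0 x v).
exact: zero_ext_near0.
Qed.

(** Heine-Cantor on [K]. The covering argument compares a point of [K] with an arbitrary one, so a
    pair with only one point in [K] is treated from that point. *)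
Lemma continuous_compact_ucont f : continuous f -> (forall x, ~ K x -> f x = 0) ->
  ucont f.
Proof.
move=> cf f0 e e0.
have cptK : compact K by exact: bounded_closed_compact.
have /compact_near_coveringP := cptK.
move=> /(_ R (nbhs (0 : R)^'+) (fun d x => forall y, `|x - y| < d -> `|f x - f y| < e)).
case.
  move=> x Kx; have e20 : 0 < e / 2 by rewrite divr_gt0.
  have [r r0 H] := cont_rV_dist (cf x) e20.
  exists ([set y | `|x - y| < r / 2], [set d | d < r / 2]).
    split => /=.
      have -> : [set y | `|x - y| < r / 2] = ball x (r / 2) by rewrite -ball_normE.
      by apply: nbhsx_ballx; rewrite divr_gt0.
    by apply: nbhs_right_lt; rewrite divr_gt0.
  move=> [y d] /= [xy dr] z yz; rewrite (splitr e).
  have -> : f y - f z = (f x - f z) - (f x - f y) by ring.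
  apply: le_lt_trans (ler_normB _ _) _; apply: ltrD; apply: H; last first.
    by apply: lt_le_trans xy _; rewrite ler_pdivrMr // ler_pMr // ler1n.
  rewrite (splitr r); have -> : x - z = (x - y) + (y - z) by rewrite addrA subrK.
  apply: le_lt_trans (ler_normD _ _) _; apply: ltrD => //; exact: lt_trans dr.
move=> d0 /= d00 H.
exists (d0 / 2); first by rewrite divr_gt0.
have {}H x : K x -> forall y, `|x - y| < d0 / 2 -> `|f x - f y| < e.
  move=> Kx; apply: H => //=; last by rewrite divr_gt0.
  rewrite /ball_ /= sub0r normrN gtr0_norm ?divr_gt0 //.
  by rewrite ltr_pdivrMr // ltr_pMr // ltr1n.
move=> x y xy; have [Kx|Kx] := pselect (K x); first exact: H.
have [Ky|Ky] := pselect (K y); last by rewrite !f0 // subrr normr0.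
by rewrite distrC; apply: H => //; rewrite distrC.
Qed.

Lemma bounded_tail_supp f : (forall x, ~ K x -> f x = 0) ->
  exists2 M : R, 0 < M & tail_supp 0 M f.
Proof.
move=> f0; have [M [_ H]] := bK.
exists (`|M| + 1); first by rewrite ltr_wpDl.
move=> x [j [_ jx]]; apply: f0 => Kx.
have /= := H (`|M| + 1) _ _ Kx.
rewrite ltr_pwDr ?ler_norm // => /(_ isT).
apply/negP; rewrite -ltNge; apply: lt_le_trans jx _.
exact: coord_le_norm.
Qed.

Lemma zero_ext_notK f : (forall y, U y -> ~ K y -> f y = 0) ->
  forall x, ~ K x -> zero_ext U f x = 0.
Proof. by move=> f0 x Kx; rewrite /zero_ext; case: asboolP => // Ux; exact: f0. Qed.

Lemma Ctail_zero_ext f : (forall x, U x -> {for x, continuous f}) ->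
  (forall y, U y -> ~ K y -> f y = 0) -> Ctail 0 (zero_ext U f).
Proof.
move=> cf f0; have n0 := zero_ext_notK f0; split; last exact: bounded_tail_supp.
by apply: continuous_compact_ucont => //; exact: zero_ext_cont.
Qed.

Lemma is_derive_uderiv i f g : (forall x, is_derive x (evec R i) f (g x)) ->
  ucont g -> uderiv i f g.
Proof.
move=> df ug e e0; have [d d0 H] := ug e e0; exists d => // x h hd.
have P y k : 0 < k -> k < d -> exists2 c : R, 0 < c < k &
    f (y + k *: evec R i) - f y = k * g (y + c *: evec R i).
  move=> k0 kd; have [|c ck ->] := @MVT_line _ _ f (evec R i) y k k0.
    by move=> t _; have [] := df (y + t *: evec R i).
  by exists c => //; have [_ ->] := df (y + c *: evec R i).
have [h0|h0|->] := ltgtP h 0; last first.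
- by rewrite scale0r addr0 subrr mul0r subr0 normr0 mulr0.
- rewrite gtr0_norm // in hd *; have [c /andP[c0 ch] ->] := P x h h0 hd.
  rewrite -mulrBr normrM gtr0_norm // mulrC ler_wpM2r ?(ltW h0) //.
  apply/ltW/H; rewrite addrC addKr; apply: le_lt_trans (evec_norm _ _) _.
  by rewrite gtr0_norm // (lt_trans ch).
(* [MVT_line] asks for a positive step, so for negative [h] it starts from [x + h *: evec R i] and
   moves back to [x]. *)
- rewrite ltr0_norm // in hd *.
  have k0 : 0 < - h by rewrite oppr_gt0.
  have [c /andP[c0 ch]] := P (x + h *: evec R i) (- h) k0 hd.
  rewrite scaleNr addrK => E.
  have -> : f (x + h *: evec R i) - f x = h * g (x + h *: evec R i + c *: evec R i).
    by rewrite -opprB E mulNr opprK.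
  rewrite -mulrBr normrM ltr0_norm // mulrC ler_wpM2r ?(ltW k0) //.
  apply/ltW/H; rewrite -(addrA x) -scalerDl (addrC x) addrK.
  apply: le_lt_trans (evec_norm _ _) _.
  by rewrite ltr0_norm; lra.
Qed.

Lemma rint_zero_ext_derive i f g : (forall x, U x -> {for x, continuous f}) ->
  (forall x, U x -> {for x, continuous g}) ->
  (forall x, U x -> is_derive x (evec R i) f (g x)) ->
  (forall y, U y -> ~ K y -> f y = 0) -> (forall y, U y -> ~ K y -> g y = 0) ->
  Ctail 0 (zero_ext U g) /\ rint N (zero_ext U g) 0 = 0.
Proof.
move=> cf cg df f0 g0.
have Cf := Ctail_zero_ext cf f0; have Cg := Ctail_zero_ext cg g0.
split => //; apply: (rint_uderiv 0 Cf Cg).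
apply: is_derive_uderiv; first exact: zero_ext_is_derive.
by case: Cg.
Qed.

End LocalizedFunctions.

(** * Cutoff profiles on the unit interval *)

Section Clamp.
Context {R : realType}.
Implicit Types (P Q : R -> R) (t e l : R).

Definition clamp t : R := Num.max 0 (Num.min 1 t).

Lemma clampP t : [/\ 0 <= clamp t, clamp t <= 1 &
  [\/ 0 <= t <= 1 /\ clamp t = t, t <= 0 /\ clamp t = 0 | 1 <= t /\ clamp t = 1]].
Proof.
rewrite /clamp; case: (leP 1 t) => h1; rewrite ?(min_l h1) ?(min_r (ltW h1)).
  by rewrite max_r //; split => //; apply: Or33.
case: (leP t 0) => h0; split => //; try exact: ltW.
  by apply: Or32.
by apply: Or31; rewrite !ltW.
Qed.

Lemma clamp_continuous : continuous clamp.
Proof.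
move=> t; apply: (@continuous_max R R (cst 0) (fun t => Num.min 1 t)).
  exact: cst_continuous.
apply: (@continuous_min R R (cst 1) id); first exact: cst_continuous.
exact: cvg_id.
Qed.

Lemma clamp_out P t : P 0 = 0 -> P 1 = 0 -> ~~ (0 <= t <= 1) -> P (clamp t) = 0.
Proof. by move=> P0 P1; case: (clampP t) => _ _ [[->]|[_ ->]|[_ ->]]. Qed.

Lemma is_derive_distP P t l : is_derive t (1 : R) P l -> forall e, 0 < e ->
  exists2 d : R, 0 < d & forall h : R, `|h| < d -> `|P (t + h) - P t - h * l| <= e * `|h|.
Proof.
move=> [dP <-] e e0.
have /cvgrPdist_le /(_ e e0) := dP.
move=> [d /= d0 H]; exists d => // h hd.
have [->|h0] := eqVneq h 0; first by rewrite addr0 subrr mul0r subr0 normr0 mulr0.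
have := H h; rewrite /= sub0r normrN => /(_ hd h0).
rewrite /GRing.scale /= mulr1 (addrC h t) => K.
rewrite -/('D_1 P t) in K.
have -> : P (t + h) - P t - h * 'D_1 P t = - (h * ('D_1 P t - h^-1 * (P (t + h) - P t))).
  by rewrite mulrBr mulVKf // opprB.
by rewrite normrN normrM mulrC ler_wpM2r.
Qed.

(** Composing with [clamp] extends [P] by zero outside the unit interval; at 0 and 1 the two
    one-sided derivatives agree because [Q] vanishes there as well. *)
Lemma clamp_is_derive P Q : (forall t, is_derive t (1 : R) P (Q t)) ->
  P 0 = 0 -> P 1 = 0 -> Q 0 = 0 -> Q 1 = 0 ->
  forall t, is_derive t (1 : R) (fun s => P (clamp s)) (Q (clamp t)).
Proof.
move=> dP P0 P1 Q0 Q1 t; apply: is_derive_dist => e e0.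
have far t1 h1 : `|h1| < `|t1| -> t1 <= 0 -> clamp t1 = 0 -> clamp (t1 + h1) = 0.
  move=> h1t t0 c0; rewrite (ler0_norm t0) in h1t; have := ler_norm h1.
  case: (clampP (t1 + h1)) => _ _ [[/andP[K _] _]|[_ ->//]|[K _]]; lra.
have [d d0 H] := is_derive_distP (dP (clamp t)) e0.
case: (clampP t) => _ _ [[/andP[t0 t1] ct]|[t0 ct]|[t1 ct]]; rewrite ct in H *.
(* [d1] stops [t + h] from reaching 0 unless [t] is 0, in which case 1 is a mere placeholder; [d2]
   does the same at the other end. *)
- pose d1 := if t == 0 then 1 else t; pose d2 := if t == 1 then 1 else 1 - t.
  have d10 : 0 < d1 by rewrite /d1; case: eqVneq => // tn0; rewrite lt_neqAle eq_sym tn0.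
  have d20 : 0 < d2 by rewrite /d2; case: eqVneq => // tn1; rewrite subr_gt0 lt_neqAle tn1.
  exists (Num.min d (Num.min d1 d2)); first by rewrite !lt_min d0 d10.
  move=> h; rewrite !lt_min => /and3P[hd h1 h2].
  have hn := ler_norm h; have hn' := ler_norm (- h); rewrite normrN in hn'.
  case: (clampP (t + h)) => _ _ [[_ ->]|[K ->]|[K ->]]; first exact: H.
  + have E : t = 0.
      by move: h1; rewrite /d1; case: eqVneq => // _ h1; lra.
    by rewrite E P0 Q0 mulr0 !subrr normr0 mulr_ge0 // ltW.
  + have E : t = 1.
      by move: h2; rewrite /d2; case: eqVneq => // _ h2; lra.
    by rewrite E P1 Q1 mulr0 !subrr normr0 mulr_ge0 // ltW.
- have [E|tn0] := eqVneq t 0.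
    exists (Num.min d 1); first by rewrite lt_min d0 /=.
    move=> h; rewrite lt_min => /andP[hd h1]; have hn := ler_norm h.
    case: (clampP (t + h)) => _ _ [[_ ->]|[K ->]|[K ->]].
    * by rewrite E; exact: H.
    * by rewrite P0 Q0 mulr0 !subrr normr0 mulr_ge0 // ltW.
    * by rewrite P0 P1 Q0 mulr0 !subrr normr0 mulr_ge0 // ltW.
  have tl0 : t < 0 by rewrite lt_neqAle tn0.
  exists (- t); first by rewrite oppr_gt0.
  move=> h ht; have hn := ler_norm h.
  case: (clampP (t + h)) => _ _ [[K _]|[K ->]|[K _]]; try lra.
  by rewrite P0 Q0 mulr0 !subrr normr0 mulr_ge0 // ltW.
- have [E|tn1] := eqVneq t 1.
    exists (Num.min d 1); first by rewrite lt_min d0 /=.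
    move=> h; rewrite lt_min => /andP[hd h1].
    have hn := ler_norm (- h); rewrite normrN in hn.
    case: (clampP (t + h)) => _ _ [[_ ->]|[K ->]|[K ->]].
    * by rewrite E; exact: H.
    * by rewrite P0 P1 Q1 mulr0 !subrr normr0 mulr_ge0 // ltW.
    * by rewrite P1 Q1 mulr0 !subrr normr0 mulr_ge0 // ltW.
  have tl1 : 1 < t by rewrite lt_neqAle eq_sym tn1.
  exists (t - 1); first by rewrite subr_gt0.
  move=> h ht; have hn := ler_norm (- h); rewrite normrN in hn.
  case: (clampP (t + h)) => _ _ [[K _]|[K _]|[K ->]]; try lra.
  by rewrite P1 Q1 mulr0 !subrr normr0 mulr_ge0 // ltW.
Qed.

End Clamp.

(** * The polynomials behind f, eta and H, with their bounds *)

Section CutoffPolynomials.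
Context {R : realType}.
Implicit Types (t : R).

(** 140 is 7! / (3! 3!), the inverse of the Beta integral. The third power is the least one for
    which the second derivative also vanishes at both endpoints, so that the clamped extension is
    twice continuously differentiable. *)
Definition mollifier t : R := 140 * (t * (1 - t)) ^+ 3.
Definition mollifier1 t : R := 420 * (t * (1 - t)) ^+ 2 * (1 - 2 * t).
Definition mollifier2 t : R := 840 * (t * (1 - t)) - 4200 * (t * (1 - t)) ^+ 2.
Definition plateau k t : R := 1 - (1 - 2 * t) ^+ (2 * k).
(* [plateau_mass k] is the integral of [plateau k] over [0, 1], while that of
   [mollifier] is [1]; hence [drift], the primitive of [drift1], vanishes at [1]. *)
Definition plateau_mass k : R := 1 - (2 * k).+1%:R^-1.
Definition drift1 k t : R := plateau k t - plateau_mass k * mollifier t.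
(** Closed forms of the primitives from 0 of [plateau k] and [mollifier]; the second is the
    smoothstep polynomial of degree seven. *)
Definition drift k t : R :=
  t - (1 - (1 - 2 * t) ^+ (2 * k).+1) / (2 * (2 * k).+1%:R)
  - plateau_mass k * (35 * t ^+ 4 - 84 * t ^+ 5 + 70 * t ^+ 6 - 20 * t ^+ 7).

Lemma is_derive_idR t : is_derive t (1 : R) (fun s : R => s) 1.
Proof. exact: is_derive_id. Qed.

Lemma is_derive_affine t (a b : R) : is_derive t (1 : R) (fun s : R => a + b * s) b.
Proof.
have H := is_deriveDf (is_derive_cst a t (1 : R)) (is_derive_cstM b (is_derive_idR t)).
by apply: (is_derive_eq H); rewrite add0r mulr1.
Qed.

Lemma is_derive_hump t : is_derive t (1 : R) (fun s : R => s * (1 - s)) (1 - 2 * t).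
Proof.
have H1 := is_deriveBf (is_derive_cst (1 : R) t (1 : R)) (is_derive_idR t).
by apply: (is_derive_eq (is_deriveMf (is_derive_idR t) H1)); rewrite /cst; ring.
Qed.

Lemma is_derive_tilt t : is_derive t (1 : R) (fun s : R => 1 - 2 * s) (-2).
Proof.
have H := is_deriveBf (is_derive_cst (1 : R) t (1 : R)) (is_derive_cstM 2 (is_derive_idR t)).
by apply: (is_derive_eq H); ring.
Qed.

Lemma is_derive_mollifier t : is_derive t (1 : R) mollifier (mollifier1 t).
Proof.
apply: (is_derive_eq (is_derive_cstM 140 (is_derive_expf 2 (is_derive_hump t)))).
by rewrite /mollifier1; ring.
Qed.

Lemma is_derive_mollifier1 t : is_derive t (1 : R) mollifier1 (mollifier2 t).
Proof.
have H := is_deriveMf (is_derive_cstM 420 (is_derive_expf 1 (is_derive_hump t))) (is_derive_tilt t).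
by apply: (is_derive_eq H); rewrite /mollifier2; ring.
Qed.

Lemma is_derive_drift k t : is_derive t (1 : R) (drift k) (drift1 k t).
Proof.
have Hm : ((2 * k).+1%:R : R) != 0 by rewrite pnatr_eq0.
have H1 := is_deriveBf (is_derive_cst (1 : R) t (1 : R)) (is_derive_expf (2 * k) (is_derive_tilt t)).
have H2 := is_deriveBf (is_derive_idR t) (is_derive_cstM (2 * (2 * k).+1%:R)^-1 H1).
have X n := is_derive_expf n (is_derive_idR t).
have H3 := is_deriveBf (is_deriveDf (is_deriveBf (is_derive_cstM 35 (X 3)) (is_derive_cstM 84 (X 4)))
  (is_derive_cstM 70 (X 5))) (is_derive_cstM 20 (X 6)).
have H := is_deriveBf H2 (is_derive_cstM (plateau_mass k) H3).
have -> : drift k = (fun s : R => s - (2 * (2 * k).+1%:R)^-1 * (1 - (1 - 2 * s) ^+ (2 * k).+1)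
  - plateau_mass k * (35 * s ^+ 4 - 84 * s ^+ 5 + 70 * s ^+ 6 - 20 * s ^+ 7)).
  by apply/funext => s; rewrite /drift [_ / _]mulrC.
apply: (is_derive_eq H); rewrite /drift1 /plateau /mollifier.
move: (plateau_mass k) ((1 - 2 * t) ^+ (2 * k)) Hm => c w.
by move: ((2 * k).+1%:R) => m Hm; field.
Qed.

Lemma mollifier_0 : mollifier 0 = 0 /\ mollifier 1 = 0. Proof. by rewrite /mollifier; split; ring. Qed.
Lemma mollifier1_0 : mollifier1 0 = 0 /\ mollifier1 1 = 0. Proof. by rewrite /mollifier1; split; ring. Qed.
Lemma mollifier2_0 : mollifier2 0 = 0 /\ mollifier2 1 = 0. Proof. by rewrite /mollifier2; split; ring. Qed.

Lemma plateau_0 k : plateau k 0 = 0 /\ plateau k 1 = 0.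
Proof.
rewrite /plateau mulr0 subr0 expr1n subrr; split => //.
rewrite mulr1 (_ : 1 - 2 = - 1 :> R); last by ring.
by rewrite exprM sqrrN expr1n expr1n subrr.
Qed.

Lemma drift1_0 k : drift1 k 0 = 0 /\ drift1 k 1 = 0.
Proof.
rewrite /drift1; have [-> ->] := plateau_0 k; have [-> ->] := mollifier_0.
by rewrite mulr0 subrr.
Qed.

Lemma drift_0 k : drift k 0 = 0 /\ drift k 1 = 0.
Proof.
have Hm : ((2 * k).+1%:R : R) != 0 by rewrite pnatr_eq0.
rewrite /drift /plateau_mass; split.
  by rewrite mulr0 subr0 expr1n subrr mul0r; ring.
rewrite mulr1 (_ : 1 - 2 = - 1 :> R); last by ring.
rewrite [(-1) ^+ _]exprS exprM sqrrN !expr1n.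
by move: ((2 * k).+1%:R) Hm => m Hm; field.
Qed.

Section Bounds.
Variables (t : R) (t0 : 0 <= t) (t1 : t <= 1).
Let u := t * (1 - t).

Lemma hump_bounds : 0 <= u <= 1 / 4.
Proof.
rewrite /u; apply/andP; split; first by rewrite mulr_ge0 // subr_ge0.
rewrite -subr_ge0 (_ : _ - _ = (t - 1 / 2) ^+ 2); last by field.
exact: sqr_ge0.
Qed.

Lemma tilt_sqr : (1 - 2 * t) ^+ 2 = 1 - 4 * u.
Proof. by rewrite /u; ring. Qed.

Lemma mollifier_bounds : 0 <= mollifier t <= 140 / 64.
Proof.
have /andP[u0 u1] := hump_bounds; rewrite /mollifier -/u; apply/andP; split.
  by rewrite mulr_ge0 // exprn_ge0.
have : u ^+ 3 <= (1 / 4) ^+ 3 by rewrite lerXn2r // ?nnegrE ?divr_ge0.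
by move: (u ^+ 3) => z; rewrite (_ : (1 / 4 : R) ^+ 3 = 1 / 64); [lra|field].
Qed.

Lemma tilt_bound : `|1 - 2 * t| <= 1.
Proof.
rewrite ler_norml lerBlDr lerDl mulr_ge0 ?ler0n // andbT lerBrDr.
rewrite (_ : -1 + 2 * t = 1 - 2 * (1 - t)); last by ring.
by rewrite lerBlDr lerDl mulr_ge0 // subr_ge0.
Qed.

(** The crude product of maxima is 420 / 16 = 26.25. *)
Lemma mollifier1_bound : `|mollifier1 t| <= 27.
Proof.
have w1 := tilt_bound.
have /andP[u0 u1] := hump_bounds; rewrite /mollifier1 -/u.
have g0 : 0 <= 420 * u ^+ 2 by apply: mulr_ge0; [exact: ler0n|exact: sqr_ge0].
rewrite normrM (ger0_norm g0).
have uu : 0 <= u ^+ 2 <= 1 / 16.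
  rewrite sqr_ge0 /=.
  have : u ^+ 2 <= (1 / 4) ^+ 2 by rewrite lerXn2r // ?nnegrE ?divr_ge0.
  by rewrite (_ : (1 / 4 : R) ^+ 2 = 1 / 16); [|field].
have /andP[z0 z1] := uu.
have : 420 * u ^+ 2 * `|1 - 2 * t| <= 420 * u ^+ 2.
  by rewrite ler_piMr.
by move: (420 * u ^+ 2 * _) => y; move: (u ^+ 2) z0 z1 => z z0 z1 H; lra.
Qed.

(** In terms of [u] this is the parabola [840 * u - 4200 * u ^+ 2], whose peak 42 lies at
    [u = 1 / 10]. *)
Lemma mollifier2_bound : mollifier2 t <= 42.
Proof.
rewrite /mollifier2 -/u -subr_ge0.
rewrite (_ : _ - _ = 4200 * (u - 1 / 10) ^+ 2); last by field.
by apply: mulr_ge0; [exact: ler0n|exact: sqr_ge0].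
Qed.

Lemma plateau_bounds k : (0 < k)%N -> 4 * u <= plateau k t /\ plateau k t <= 1.
Proof.
move=> k0; have /andP[u0 u1] := hump_bounds.
rewrite /plateau exprM tilt_sqr; split; last first.
  by rewrite gerBl exprn_ge0; lra.
rewrite -(prednK k0) exprS.
have : (1 - 4 * u) * (1 - 4 * u) ^+ k.-1 <= 1 - 4 * u.
  by rewrite ler_piMr ?exprn_ile1; lra.
lra.
Qed.

Lemma plateau_mass_bounds k : 0 <= plateau_mass k <= 1.
Proof.
rewrite /plateau_mass subr_ge0 invf_le1 ?ler1n //= gerBl invr_ge0 ler0n.
Qed.

Lemma drift1_bound k : (0 < k)%N -> `|drift1 k t| <= 3.
Proof.
move=> k0; have /andP[c0 c1] := plateau_mass_bounds k.
have /andP[b0 b1] := mollifier_bounds; have [p0 p1] := plateau_bounds k0.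
have /andP[u0 u1] := hump_bounds.
have : plateau_mass k * mollifier t <= mollifier t by rewrite ler_piMl.
have : 0 <= plateau_mass k * mollifier t by rewrite mulr_ge0.
rewrite ler_norml /drift1; move: (plateau_mass k * mollifier t) => z z0 z1.
by apply/andP; split; lra.
Qed.

End Bounds.

(** This allows the Hessian error to be absorbed up to the ends of the interval, with a constant
    independent of [k]. Vanishing at 0 and 1 and the Lipschitz constant 3 bound [drift] by 3 min(t,
    1 - t), hence by 6 t (1 - t), while [plateau] is at least 4 t (1 - t). *)
Lemma drift_bound k t : (0 < k)%N -> 0 <= t <= 1 -> `|drift k t| <= 2 * plateau k t.
Proof.
move=> k0 /andP[t0 t1].
have /andP[u0 u1] := hump_bounds t0 t1.
have [p0 p1] := plateau_bounds t0 t1 k0.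
have cD : continuous (drift k).
  move=> s; apply/differentiable_continuous/derivable1_diffP.
  by have [] := is_derive_drift k s.
have M a b : 0 <= a -> a <= b -> b <= 1 -> `|drift k b - drift k a| <= 3 * (b - a).
  move=> a0 ab b1.
  have [||c] := @MVT_segment R (drift k) (drift1 k) a b ab.
  - by move=> s _; exact: is_derive_drift.
  - exact: continuous_subspaceT.
  rewrite in_itv /= => /andP[ac cb] ->.
  rewrite normrM (ger0_norm (_ : 0 <= b - a)) ?subr_ge0 //.
  rewrite ler_wpM2r ?subr_ge0 //; apply: drift1_bound => //; lra.
have [D0 D1] := drift_0 k.
have := M 0 t (lexx _) t0 t1; have := M t 1 t0 t1 (lexx _).
rewrite D0 D1 sub0r !subr0 normrN => H1 H2.
have : `|drift k t| <= 6 * (t * (1 - t)).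
  case: (leP t (1 / 2)) => th.
    by apply: le_trans H2 _; rewrite -subr_ge0 (_ : _ - _ = 3 * t * (1 - 2 * t)); 
      [rewrite !mulr_ge0 //; lra|ring].
  apply: le_trans H1 _; rewrite -subr_ge0.
  by rewrite (_ : _ - _ = 3 * (1 - t) * (2 * t - 1)); 
      [rewrite !mulr_ge0 //; lra|ring].
move: `|_| p0 u0; move: (t * (1 - t)) (plateau k t) => u p z; lra.
Qed.

End CutoffPolynomials.

(** * A Rellich identity *)

Section RellichAlgebra.
Context {R : realType} {N : nat}.
Variables (P G : 'I_N -> R) (Q M : 'I_N -> 'I_N -> R) (f0 f1 f2 h0 h1 q : R).
Hypotheses (symQ : forall i j, Q i j = Q j i) (trQ : \sum_i Q i i = 0).
Hypothesis unitG : \sum_i G i * G i = 1.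

(** The identity at one point: [P] and [G] stand for the gradients of p and Phi, [Q] and [M] for
    their Hessians. Second derivatives of p disappear: the trace by harmonicity, the rest because
    the contributions of the gradients of [d] and [S] cancel by symmetry of [Q]. *)
Lemma sum_rellich (S d : R) : d = \sum_i G i * P i -> S = \sum_i P i * P i ->
  \sum_i (f0 * (q * Q i i + P i * P i) + q * P i * (f1 * G i)
  - (f1 * (2^-1 * (q * q) * M i i + G i * (2^-1 * (q * P i + q * P i)))
     + 2^-1 * (q * q) * G i * (f2 * G i))
  - (2 * (h0 * (d * Q i i + P i * (\sum_j (G j * Q j i + P j * M j i)))
          + d * P i * (h1 * G i))
     - (h0 * (S * M i i + G i * (\sum_j (P j * Q j i + P j * Q j i)))
        + S * G i * (h1 * G i)))) =
  f0 * S + h1 * (S - 2 * d ^+ 2)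
  - 2^-1 * q ^+ 2 * (f2 + f1 * \sum_i M i i)
  - h0 * (2 * \sum_i \sum_j M j i * P j * P i - (\sum_i M i i) * S).
Proof.
move=> dE SE.
pose D i := \sum_j (G j * Q j i + P j * M j i).
pose T i := \sum_j (P j * Q j i + P j * Q j i).
under eq_bigr => i _ do rewrite -/(D i) -/(T i).
have E i : f0 * (q * Q i i + P i * P i) + q * P i * (f1 * G i)
  - (f1 * (2^-1 * (q * q) * M i i + G i * (2^-1 * (q * P i + q * P i)))
     + 2^-1 * (q * q) * G i * (f2 * G i))
  - (2 * (h0 * (d * Q i i + P i * D i) + d * P i * (h1 * G i))
     - (h0 * (S * M i i + G i * T i) + S * G i * (h1 * G i))) =
   f0 * (P i * P i) + (f0 * q - 2 * h0 * d) * Q i i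
   + (- 2^-1 * q ^+ 2 * f2 + h1 * S) * (G i * G i)
   + (- 2^-1 * q ^+ 2 * f1 + h0 * S) * M i i
   + (- 2 * h1 * d) * (G i * P i) + (- 2 * h0) * (P i * D i) + h0 * (G i * T i).
  by move: (D i) (T i) => y z; field.
rewrite (eq_bigr _ (fun i _ => E i)) !big_split /= -!mulr_sumr.
rewrite trQ unitG -SE -dE.
have E1 : \sum_i P i * D i =
    \sum_i \sum_j M j i * P j * P i + \sum_i \sum_j P i * (G j * Q j i).
  rewrite -big_split /=; apply: eq_bigr => i _.
  by rewrite mulr_sumr -big_split /=; apply: eq_bigr => j _; ring.
have E2 : \sum_i G i * T i = 2 * \sum_i \sum_j P i * (G j * Q j i).
  rewrite exchange_big mulr_sumr /=; apply: eq_bigr => i _.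
  by rewrite !mulr_sumr; apply: eq_bigr => j _; rewrite (symQ i j); ring.
rewrite E1 E2.
move: (\sum_i M i i) (\sum_i \sum_j _) (\sum_i \sum_j _) => a b c.
by ring.
Qed.

End RellichAlgebra.

Section Rellich.
Context {R : realType} {N : nat}.
Notation V := 'rV[R]_N.
Implicit Types (x y : V) (i j : 'I_N).
Variables (U K : set V).
Hypotheses (oU : open U) (cK : closed K) (bK : bounded_set K) (KU : K `<=` U).
Variables (P G : 'I_N -> V -> R) (Q M : 'I_N -> 'I_N -> V -> R) (q Phi : V -> R).
Variables (F0 F1 F2 H0 H1 : R -> R).
Hypotheses (cP : forall i x, U x -> {for x, continuous (P i)})
  (cG : forall i x, U x -> {for x, continuous (G i)})
  (cQ : forall i j x, U x -> {for x, continuous (Q i j)})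
  (cM : forall i j x, U x -> {for x, continuous (M i j)})
  (cq : forall x, U x -> {for x, continuous q})
  (cPhi : forall x, U x -> {for x, continuous Phi}).
Hypotheses (dP : forall i j x, U x -> is_derive x (evec R i) (P j) (Q j i x))
  (dG : forall i j x, U x -> is_derive x (evec R i) (G j) (M j i x))
  (dq : forall i x, U x -> is_derive x (evec R i) q (P i x))
  (dPhi : forall i x, U x -> is_derive x (evec R i) Phi (G i x)).
Hypotheses (symQ : forall i j x, U x -> Q i j x = Q j i x)
  (trQ : forall x, U x -> \sum_i Q i i x = 0)
  (unitG : forall x, U x -> \sum_i G i x * G i x = 1).
Hypotheses (dF0 : forall r : R, is_derive r (1 : R) F0 (F1 r))
  (dF1 : forall r : R, is_derive r (1 : R) F1 (F2 r))
  (dH0 : forall r : R, is_derive r (1 : R) H0 (H1 r))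
  (cF0 : continuous F0) (cF1 : continuous F1) (cF2 : continuous F2)
  (cH0 : continuous H0) (cH1 : continuous H1).
Hypothesis off : forall x, U x -> ~ K x ->
  [/\ F0 (Phi x) = 0, F1 (Phi x) = 0, F2 (Phi x) = 0, H0 (Phi x) = 0 & H1 (Phi x) = 0].

Definition gsq x := \sum_j P j x * P j x.
Definition gdot x := \sum_j G j x * P j x.

Definition rellich_div x := F0 (Phi x) * gsq x + H1 (Phi x) * (gsq x - 2 * gdot x ^+ 2)
  - 2^-1 * q x ^+ 2 * (F2 (Phi x) + F1 (Phi x) * \sum_i M i i x)
  - H0 (Phi x) * (2 * \sum_i \sum_j M j i x * P j x * P i x - (\sum_i M i i x) * gsq x).

(* The [i]-th component of
   [F0 q grad p - (q^2 / 2) F1 grad Phi - (2 H0 (grad Phi . grad p) grad p - H0 |grad p|^2 grad Phi)],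
   the last bracket being the Rellich field. *)
Definition rellich_field i x :=
  F0 (Phi x) * (q x * P i x) - F1 (Phi x) * (2^-1 * (q x * q x) * G i x)
  - (2 * (H0 (Phi x) * (gdot x * P i x)) - H0 (Phi x) * (gsq x * G i x)).

(** Written in the very shape that the product rules produce, so that [is_derive_rellich_field] is a
    composition of those rules; [sum_drellich] does the simplification. *)
Definition drellich i x :=
  F0 (Phi x) * (q x * Q i i x + P i x * P i x) + q x * P i x * (F1 (Phi x) * G i x)
  - (F1 (Phi x) * (2^-1 * (q x * q x) * M i i x + G i x * (2^-1 * (q x * P i x + q x * P i x)))
     + 2^-1 * (q x * q x) * G i x * (F2 (Phi x) * G i x))
  - (2 * (H0 (Phi x) * (gdot x * Q i i x + P i x * (\sum_j (G j x * Q j i x + P j x * M j i x)))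
          + gdot x * P i x * (H1 (Phi x) * G i x))
     - (H0 (Phi x) * (gsq x * M i i x + G i x * (\sum_j (P j x * Q j i x + P j x * Q j i x)))
        + gsq x * G i x * (H1 (Phi x) * G i x))).

Lemma sum_drellich x : U x -> \sum_i drellich i x = rellich_div x.
Proof.
move=> Ux; rewrite /drellich /rellich_div.
apply: (@sum_rellich _ _ (P^~ x) (G^~ x) (fun i j => Q i j x) (fun i j => M i j x)) => //.
- by move=> i j; exact: symQ.
- exact: trQ.
- exact: unitG.
Qed.

Lemma cont_compR (F : R -> R) x : U x -> continuous F ->
  {for x, continuous (fun y => F (Phi y))}.
Proof.
by move=> Ux cF; apply: (@continuous_comp _ _ _ Phi F); [exact: cPhi|exact: cF].
Qed.

Lemma cont_gsq x : U x -> {for x, continuous gsq}.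
Proof. by move=> Ux; apply: cont_sum => j; apply: cont_mul; exact: cP. Qed.

Lemma cont_gdot x : U x -> {for x, continuous gdot}.
Proof.
by move=> Ux; apply: cont_sum => j; apply: cont_mul; [exact: cG|exact: cP].
Qed.

Let cst_cont c x : {for x, continuous (fun _ : V => c : R)}.
Proof. exact: (@cst_continuous V R c x). Qed.

Lemma cont_rellich_field i x : U x -> {for x, continuous (rellich_field i)}.
Proof.
move=> Ux.
have c0 := cont_compR Ux cF0; have c1 := cont_compR Ux cF1; have ch := cont_compR Ux cH0.
have cp := @cP i x Ux; have cg := @cG i x Ux; have cq' := cq Ux.
have cd := cont_gdot Ux; have cs := cont_gsq Ux.
exact: (cont_sub (cont_sub (cont_mul c0 (cont_mul cq' cp))
    (cont_mul c1 (cont_mul (cont_mul (@cst_cont _ x) (cont_mul cq' cq')) cg)))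
  (cont_sub (cont_mul (@cst_cont _ x) (cont_mul ch (cont_mul cd cp)))
    (cont_mul ch (cont_mul cs cg)))).
Qed.

Lemma cont_drellich i x : U x -> {for x, continuous (drellich i)}.
Proof.
move=> Ux.
have c0 := cont_compR Ux cF0; have c1 := cont_compR Ux cF1; have ch := cont_compR Ux cH0.
have c2 := cont_compR Ux cF2; have ch1 := cont_compR Ux cH1.
have cp := @cP i x Ux; have cg := @cG i x Ux; have cq' := cq Ux.
have cd := cont_gdot Ux; have cs := cont_gsq Ux.
have cQi := @cQ i i x Ux; have cMi := @cM i i x Ux.
have cdd : {for x, continuous (fun x => \sum_j (G j x * Q j i x + P j x * M j i x))}.
  apply: cont_sum => j.
  exact: (cont_add (cont_mul (@cG j x Ux) (@cQ j i x Ux)) (cont_mul (@cP j x Ux) (@cM j i x Ux))).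
have cds : {for x, continuous (fun x => \sum_j (P j x * Q j i x + P j x * Q j i x))}.
  apply: cont_sum => j.
  exact: (cont_add (cont_mul (@cP j x Ux) (@cQ j i x Ux)) (cont_mul (@cP j x Ux) (@cQ j i x Ux))).
have k c := @cst_cont c x.
have cqq := cont_mul (k 2^-1) (cont_mul cq' cq').
have cqp := cont_mul cq' cp.
have A := cont_add (cont_mul c0 (cont_add (cont_mul cq' cQi) (cont_mul cp cp)))
  (cont_mul cqp (cont_mul c1 cg)).
have B := cont_add (cont_mul c1 (cont_add (cont_mul cqq cMi)
  (cont_mul cg (cont_mul (k 2^-1) (cont_add cqp cqp)))))
  (cont_mul (cont_mul cqq cg) (cont_mul c2 cg)).
have C := cont_mul (k 2) (cont_add (cont_mul ch (cont_add (cont_mul cd cQi) (cont_mul cp cdd)))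
  (cont_mul (cont_mul cd cp) (cont_mul ch1 cg))).
have D := cont_add (cont_mul ch (cont_add (cont_mul cs cMi) (cont_mul cg cds)))
  (cont_mul (cont_mul cs cg) (cont_mul ch1 cg)).
exact: (cont_sub (cont_sub A B) (cont_sub C D)).
Qed.

Lemma is_derive_rellich_field i x : U x ->
  is_derive x (evec R i) (rellich_field i) (drellich i x).
Proof.
move=> Ux.
have dC (F F' : R -> R) (dF : forall r : R, is_derive r (1 : R) F (F' r)) :
    is_derive x (evec R i) (fun y => F (Phi y)) (F' (Phi x) * G i x).
  exact: is_derive_compf (cPhi Ux) (dF _) (@dPhi i x Ux).
have dd : is_derive x (evec R i) gdot (\sum_j (G j x * Q j i x + P j x * M j i x)).
  by apply: is_derive_sumf => j; apply: is_deriveMf; [exact: dG|exact: dP].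
have ds : is_derive x (evec R i) gsq (\sum_j (P j x * Q j i x + P j x * Q j i x)).
  by apply: is_derive_sumf => j; apply: is_deriveMf; exact: dP.
have d0 := dC F0 F1 dF0; have d1 := dC F1 F2 dF1; have dh := dC H0 H1 dH0.
have dp := @dP i i x Ux; have dg := @dG i i x Ux; have dq' := @dq i x Ux.
exact: (is_deriveBf (is_deriveBf (is_deriveMf d0 (is_deriveMf dq' dp))
    (is_deriveMf d1 (is_deriveMf (is_derive_cstM 2^-1 (is_deriveMf dq' dq')) dg)))
  (is_deriveBf (is_derive_cstM 2 (is_deriveMf dh (is_deriveMf dd dp)))
    (is_deriveMf dh (is_deriveMf ds dg)))).
Qed.

Lemma rint_rellich : Ctail 0 (zero_ext U rellich_div) /\ rint N (zero_ext U rellich_div) 0 = 0.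
Proof.
have H i : Ctail 0 (zero_ext U (drellich i)) /\ rint N (zero_ext U (drellich i)) 0 = 0.
  apply: (@rint_zero_ext_derive _ _ U K _ _ _ _ i (rellich_field i)) => //.
  - exact: cont_rellich_field.
  - exact: cont_drellich.
  - exact: is_derive_rellich_field.
  - by move=> x Ux Kx; rewrite /rellich_field; have [-> -> _ -> _] := off Ux Kx; ring.
  - by move=> x Ux Kx; rewrite /drellich; have [-> -> -> -> ->] := off Ux Kx; ring.
have -> : zero_ext U rellich_div = (fun x => \sum_i zero_ext U (drellich i) x).
  apply/funext => x; rewrite /zero_ext; case: asboolP => Ux; last by rewrite big1.
  by rewrite sum_drellich.
split; first by apply: Ctail_sum => i; have [] := H i.
rewrite rint_sum //; last by move=> i; have [] := H i.
by rewrite big1 // => i _; have [] := H i.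
Qed.

End Rellich.

(** * The distance to the boundary *)

Section EuclideanNorm.
Context {R : realType} {N : nat}.
Notation V := 'rV[R]_N.
Implicit Types (a b c x y v : V) (k t : R).

Lemma dotpC a b : dotp a b = dotp b a.
Proof. by apply: eq_bigr => i _; rewrite mulrC. Qed.

Lemma dotpDl a b c : dotp (a + b) c = dotp a c + dotp b c.
Proof. by rewrite -big_split /=; apply: eq_bigr => i _; rewrite mxE mulrDl. Qed.

Lemma dotpZl k a c : dotp (k *: a) c = k * dotp a c.
Proof. by rewrite mulr_sumr; apply: eq_bigr => i _; rewrite mxE mulrA. Qed.

Lemma dotpDr a b c : dotp c (a + b) = dotp c a + dotp c b.
Proof. by rewrite dotpC dotpDl !(dotpC c). Qed.

Lemma dotpZr k a c : dotp c (k *: a) = k * dotp c a.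
Proof. by rewrite dotpC dotpZl (dotpC c). Qed.

Lemma dotpNl a c : dotp (- a) c = - dotp a c.
Proof. by rewrite -scaleN1r dotpZl mulN1r. Qed.

Lemma dotpNr a c : dotp c (- a) = - dotp c a.
Proof. by rewrite dotpC dotpNl (dotpC c). Qed.

Definition dotpE := (dotpDl, dotpDr, dotpZl, dotpZr, dotpNl, dotpNr).

Lemma dotp_ge0 a : 0 <= dotp a a.
Proof. by apply: sumr_ge0 => i _; rewrite -expr2 sqr_ge0. Qed.

Lemma enorm_ge0 a : 0 <= enorm a. Proof. exact: sqrtr_ge0. Qed.

Lemma sqr_enorm a : enorm a ^+ 2 = dotp a a.
Proof. by rewrite sqr_sqrtr // dotp_ge0. Qed.

Lemma coord_le_enorm a i : `|a 0 i| <= enorm a.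
Proof.
rewrite -ler_sqr ?nnegrE ?enorm_ge0 // sqr_enorm real_normK ?num_real //.
rewrite /dotp (bigD1 i) //= -expr2 lerDl.
by apply: sumr_ge0 => j _; rewrite -expr2 sqr_ge0.
Qed.

Lemma norm_le_enorm a : `|a| <= enorm a.
Proof.
rewrite [leLHS]/Num.norm /= mx_normrE; apply/bigmax_leP; split; first exact: enorm_ge0.
by move=> -[i j] _ /=; rewrite (ord1 i); exact: coord_le_enorm.
Qed.

(** Neighbourhoods of row vectors come from the maximum norm, distances to the boundary from the
    Euclidean one. The factor [N], cruder than its square root, suffices to compare them. *)
Lemma enorm_le_norm a : enorm a <= N%:R * `|a|.
Proof.
rewrite -ler_sqr ?nnegrE ?enorm_ge0 ?mulr_ge0 // sqr_enorm exprMn.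
have : dotp a a <= \sum_(i < N) `|a| ^+ 2.
  apply: ler_sum => i _; rewrite -expr2 -real_normK ?num_real //.
  by rewrite ler_sqr ?nnegrE //; exact: coord_le_norm.
move=> /le_trans; apply; rewrite sumr_const card_ord -[leLHS]mulr_natl.
apply: ler_wpM2r; first exact: sqr_ge0.
by case: (N) => [|n]; rewrite ?expr0n // -natrX ler_nat leq_pmulr.
Qed.

Lemma enorm_eq0 a : enorm a = 0 -> a = 0.
Proof.
move=> a0; apply/rowP => i; rewrite mxE; apply/eqP; rewrite -normr_le0 -a0.
exact: coord_le_enorm.
Qed.

(** Cauchy-Schwarz, by expanding the square of [enorm b *: a - enorm a *: b]. *)
Lemma dotp_le a b : dotp a b <= enorm a * enorm b.
Proof.
have [/enorm_eq0 ->|a0] := eqVneq (enorm a) 0.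
  by rewrite -(scale0r 0) !dotpZl mul0r mulr_ge0 ?enorm_ge0.
have [/enorm_eq0 ->|b0] := eqVneq (enorm b) 0.
  by rewrite -(scale0r 0) !dotpZr mul0r mulr_ge0 ?enorm_ge0.
have ap : 0 < enorm a by rewrite lt_neqAle eq_sym a0 enorm_ge0.
have bp : 0 < enorm b by rewrite lt_neqAle eq_sym b0 enorm_ge0.
have := dotp_ge0 (enorm b *: a - enorm a *: b).
rewrite !dotpE (dotpC b a) -!sqr_enorm => H.
have {H} : 0 <= 2 * ((enorm a * enorm b) * (enorm a * enorm b - dotp a b)).
  by apply: le_trans H _; rewrite le_eqVlt; apply/orP; left; apply/eqP; ring.
rewrite pmulr_rge0 //.
by rewrite pmulr_rge0 ?mulr_gt0 // subr_ge0.
Qed.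

Lemma enormD a b : enorm (a + b) <= enorm a + enorm b.
Proof.
rewrite -ler_sqr ?nnegrE ?addr_ge0 ?enorm_ge0 // sqr_enorm !dotpE (dotpC b a).
rewrite sqrrD -!sqr_enorm; have := dotp_le a b.
by move: (dotp a b) (enorm a) (enorm b) => z u w H; lra.
Qed.

Lemma enormZ k a : enorm (k *: a) = `|k| * enorm a.
Proof. by rewrite /enorm !dotpE mulrA -expr2 sqrtrM ?sqr_ge0 // sqrtr_sqr. Qed.

Lemma enormN a : enorm (- a) = enorm a.
Proof. by rewrite -scaleN1r enormZ normrN normr1 mul1r. Qed.

Lemma enormB a b : enorm (a - b) = enorm (b - a).
Proof. by rewrite -opprB enormN. Qed.

Lemma enorm_tri a b c : enorm (a - c) <= enorm (a - b) + enorm (b - c).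
Proof. by have -> : a - c = (a - b) + (b - c); [rewrite addrA subrK|exact: enormD]. Qed.

Lemma enorm0 : enorm (0 : V) = 0.
Proof. by rewrite -(scale0r 0) enormZ normr0 mul0r. Qed.

(* Tangent-line bound for the concave square root. *)
Lemma enorm_shift_le a v t : 0 < enorm a ->
  enorm (a + t *: v) <= enorm a + t * (dotp a v / enorm a) + t ^+ 2 * (dotp v v / (2 * enorm a)).
Proof.
move=> a0; set D := enorm a.
have -> : D + t * (dotp a v / D) + t ^+ 2 * (dotp v v / (2 * D))
   = D / 2 + dotp (a + t *: v) (a + t *: v) / (2 * D).
  rewrite !dotpE (dotpC v a) -(sqr_enorm a) -/D.
  by field; rewrite gt_eqF.
rewrite -sqr_enorm; move: (enorm (a + t *: v)) => E.
rewrite -subr_ge0 (_ : _ - _ = (E - D) ^+ 2 / (2 * D)).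
  by rewrite divr_ge0 ?sqr_ge0 // mulr_ge0 // ltW.
by field; rewrite gt_eqF.
Qed.

End EuclideanNorm.

(** * Attainment, continuity and two-sided bounds of the distance *)

Section DistanceToBoundary.
Context {R : realType} {N : nat}.
Notation V := 'rV[R]_N.
Implicit Types (x y z v : V) (s t r rho : R).
Variable Omega : set V.
Hypotheses (oO : open Omega) (bO : bounded_set Omega) (B0 : bdry Omega !=set0).
Let Gam := bdry Omega.

Lemma bounded_closure : bounded_set (closure Omega).
Proof.
have [M [Mr H]] := bO; exists M; split => // M' MM' x Kx.
apply/ler_addgt0Pr => e e0.
have [y [Oy xy]] := Kx _ (nbhsx_ballx x e e0).
rewrite -ball_normE /= in xy.
have -> : x = y + (x - y) by rewrite addrC subrK.
apply: le_trans (ler_normD _ _) _; apply: lerD; last exact: ltW.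
exact: H Oy.
Qed.

Lemma bdry_closed : closed Gam.
Proof.
rewrite /Gam /bdry setDE; apply: closedI; first exact: closed_closure.
exact: open_closedC.
Qed.

Lemma bdry_compact : compact Gam.
Proof.
apply: bounded_closed_compact; last exact: bdry_closed.
have [M [Mr H]] := bounded_closure; exists M; split => // M' MM' x [Kx _].
exact: H.
Qed.

Lemma dist_lbound x : lbound [set enorm (x - y) | y in Gam] 0.
Proof. by move=> _ [y _ <-]; exact: enorm_ge0. Qed.

Lemma distG_le x y : Gam y -> distG Omega x <= enorm (x - y).
Proof.
by move=> Gy; apply: ge_inf; [exists 0; exact: dist_lbound|exists y].
Qed.

Lemma le_distG x r : (forall y, Gam y -> r <= enorm (x - y)) -> r <= distG Omega x.
Proof.
move=> H; apply: lb_le_inf; last by move=> _ [y Gy <-]; exact: H.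
by have [y Gy] := B0; exists (enorm (x - y)); exists y.
Qed.

Lemma enorm_sub_cont x : continuous (fun y : V => enorm (x - y)).
Proof.
suff H (y : V) : {for y, continuous (fun y : V => enorm (x - y))} by move=> y; exact: H.
apply: dist_cont_rV => e e0.
have d0 : 0 < e / (N%:R + 1) by rewrite divr_gt0 // ltr_wpDl.
exists (e / (N%:R + 1)) => // z yz.
have L a b : enorm (x - a) - enorm (x - b) <= enorm (a - b).
  by rewrite lerBlDr (enormB x a) (enormB x b); exact: enorm_tri.
have : enorm (y - z) < e.
  apply: le_lt_trans (enorm_le_norm _) _.
  apply: le_lt_trans (_ : (N%:R + 1) * `|y - z| < e).
    by rewrite ler_wpM2r // lerDl.
  by rewrite mulrC -ltr_pdivlMr // ltr_wpDl.
move=> yze; rewrite ltr_norml; apply/andP; split.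
  by rewrite ltrNl opprB; apply: le_lt_trans (L _ _) _; rewrite enormB.
by apply: le_lt_trans (L _ _) _.
Qed.

Lemma distG_attained x : exists2 y, Gam y & distG Omega x = enorm (x - y).
Proof.
have [|y Gy H] := @compact_EVT_min V R (fun y => enorm (x - y)) Gam B0 bdry_compact.
  by apply: continuous_subspaceT; exact: enorm_sub_cont.
exists y; first by rewrite inE in Gy.
apply/eqP; rewrite eq_le distG_le /=; last by rewrite inE in Gy.
by apply: le_distG => z Gz; apply: H; rewrite inE.
Qed.

Lemma distG_lip x y : distG Omega x <= distG Omega y + enorm (x - y).
Proof.
have [z Gz ->] := distG_attained y; rewrite addrC.
by apply: le_trans (distG_le x Gz) _; exact: enorm_tri.
Qed.

Lemma distG_cont : continuous (distG Omega).
Proof.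
suff H (x : V) : {for x, continuous (distG Omega)} by move=> x; exact: H.
apply: dist_cont_rV => e e0.
have [r r0 H] := cont_rV_dist (@enorm_sub_cont x x) e0; exists r => // y /H.
rewrite subrr enorm0 sub0r normrN ger0_norm ?enorm_ge0 // => xy.
rewrite ltr_norml; apply/andP; split.
  by rewrite ltrNl opprB ltrBlDl; apply: le_lt_trans (distG_lip _ x) _; rewrite enormB ltrD2l.
by rewrite ltrBlDl; apply: le_lt_trans (distG_lip _ y) _; rewrite ltrD2l.
Qed.

Lemma distG_gt0 x : Omega x -> 0 < distG Omega x.
Proof.
move=> Ox; have [y [_ Oy] ->] := distG_attained x.
rewrite lt_neqAle enorm_ge0 andbT eq_sym; apply/eqP => /enorm_eq0 /eqP.
by rewrite subr_eq0 => /eqP xy; apply: Oy; rewrite -xy.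
Qed.

Lemma strip_open s : open (strip Omega s).
Proof.
apply: openI => //.
by have := (@open_comp _ _ (distG Omega) [set r | r < s]) (fun x _ => @distG_cont x) (@open_lt R s).
Qed.

(** A limit point outside [Omega] would lie on the boundary and be at distance 0, which [0 < a]
    excludes. *)
Lemma annulus_closed (a b : R) : 0 < a -> closed [set x | Omega x /\ a <= distG Omega x <= b].
Proof.
move=> a0.
have -> : [set x | Omega x /\ a <= distG Omega x <= b] =
    closure Omega `&` (distG Omega @^-1` [set r | a <= r] `&` distG Omega @^-1` [set r | r <= b]).
  apply/seteqP; split => x.
    by move=> [Ox /andP[ax xb]]; split => //; exact: subset_closure.
  move=> [cx [/= ax xb]]; split; last by rewrite ax xb.
  apply: contrapT => Ox; have := distG_le x (conj cx Ox : Gam x).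
  by rewrite subrr enorm0 leNgt (lt_le_trans a0 ax).
apply: closedI; first exact: closed_closure.
apply: closedI; apply: closed_comp => [x _|]; try exact: distG_cont.
  exact: closed_ge.
exact: closed_le.
Qed.

(** If the segment missed the boundary, the parameters landing in [Omega] would form a nonempty open
    and closed part of the unit interval, hence all of it. *)
Lemma segment_meets_bdry x z : Omega x -> ~ Omega z ->
  exists2 t, 0 <= t <= 1 & Gam (x + t *: (z - x)).
Proof.
move=> Ox Oz; apply: contrapT => H.
pose f t : V := x + t *: (z - x).
have cf : continuous f.
  move=> t; apply: cvgD; first exact: cvg_cst.
  exact: scalel_continuous.
have E : `[0, 1]%classic `&` f @^-1` Omega = `[0, 1]%classic.
  apply: (@segment_connected R 0 1).
  - exists 0; split; first by rewrite /= in_itv /= lexx ler01.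
    by rewrite /= /f scale0r addr0.
  - exists (f @^-1` Omega) => //; apply: open_comp => // t _; exact: cf.
  - exists (f @^-1` closure Omega).
      by apply: closed_comp => [t _|]; [exact: cf|exact: closed_closure].
    apply/seteqP; split => t [t01 Ot]; split => //; first exact: subset_closure.
    apply: contrapT => nO; apply: H; exists t; first by rewrite /= in_itv in t01.
    by split.
have : `[0, 1]%classic (1 : R) by rewrite /= in_itv /= lexx ler01.
by rewrite -E => -[_]; rewrite /= /f scale1r addrC subrK.
Qed.

Lemma distG_le_exterior x z rho : 0 < rho -> Omega x ->
  (forall w, enorm (w - z) < rho -> ~ Omega w) -> distG Omega x <= enorm (x - z) - rho.
Proof.
move=> rho0 Ox ext.
set D := enorm (x - z).
have Drho : rho <= D by rewrite leNgt; apply/negP => /ext.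
have D0 : 0 < D := lt_le_trans rho0 Drho.
apply/ler_addgt0Pr => e e0.
(* The exterior ball is open, so the target [w] is taken at distance [r < rho] from its centre, on
   the segment towards [x]; the maximum with 0 covers [e > rho]. *)
pose r := Num.max 0 (rho - e).
have r0 : 0 <= r by rewrite le_max lexx.
have rrho : r < rho by rewrite gt_max rho0 ltrBlDr ltrDl.
pose w := z + (r / D) *: (x - z).
have Ow : ~ Omega w.
  by apply: ext; rewrite /w addrC addKr enormZ ger0_norm ?divr_ge0 ?(ltW D0) // divfK ?gt_eqF.
have [t /andP[t0 t1] Gw] := segment_meets_bdry Ox Ow.
apply: le_trans (distG_le x Gw) _.
rewrite opprD addrA subrr sub0r enormN enormZ (ger0_norm t0).
have -> : w - x = ((r / D) - 1) *: (x - z).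
  by rewrite scalerBl scale1r opprB /w [z + _]addrC -addrA.
rewrite enormZ -/D.
have -> : `|r / D - 1| = 1 - r / D.
  by rewrite ler0_norm ?opprB // subr_le0 ler_pdivrMr // mul1r (le_trans (ltW rrho)).
have -> : (1 - r / D) * D = D - r by rewrite mulrBl mul1r divfK ?gt_eqF.
apply: le_trans (_ : D - r <= _).
  by rewrite ler_piMl // subr_ge0 (le_trans (ltW rrho)).
have : rho - e <= r by rewrite le_max lexx orbT.
lra.
Qed.

Lemma distG_ge_interior x z rho :
  (forall w, enorm (w - z) < rho -> Omega w) -> rho - enorm (x - z) <= distG Omega x.
Proof.
move=> int; apply: le_distG => y [_ Oy].
have : rho <= enorm (y - z) by rewrite leNgt; apply/negP => /int.
have := enorm_tri y x z; rewrite (enormB y x).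
by move: (enorm _) (enorm _) (enorm _) => p q r; lra.
Qed.

(** [nu] is the inward direction at [y]. *)
Definition two_sided_ball rho y := exists2 nu : V, enorm nu = 1 &
  (forall w, enorm (w - (y + rho *: nu)) < rho -> Omega w) /\
  (forall w, enorm (w - (y - rho *: nu)) < rho -> ~ Omega w).

(* Both touching balls are centred on the normal line through [x]. *)
Lemma touching_balls rho x : 0 < rho -> (forall y, Gam y -> two_sided_ball rho y) ->
  Omega x -> distG Omega x < rho ->
  exists z1 z2, [/\ enorm (x - z1) = distG Omega x + rho,
    enorm (x - z2) = rho - distG Omega x,
    (forall w, Omega w -> distG Omega w <= enorm (w - z1) - rho) &
    (forall w, rho - enorm (w - z2) <= distG Omega w)].
Proof.
move=> rho0 balls Ox xrho; have [y Gy xy] := distG_attained x.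
have [nu nu1 [int ext]] := balls y Gy.
set t := distG Omega x in xy xrho *.
exists (y - rho *: nu), (y + rho *: nu).
have up := fun w Ow => @distG_le_exterior w _ rho rho0 Ow ext.
have nn : dotp nu nu = 1 by rewrite -sqr_enorm nu1 expr1n.
have aa : dotp (x - y) (x - y) = t ^+ 2 by rewrite -sqr_enorm -xy.
(* The triangle inequality through [y] gives one bound and the exterior ball the other. Equality in
   the triangle inequality then forces [x - y] to be a nonnegative multiple of [nu], as derived in
   [an] and [E2]. *)
have E1 : enorm (x - (y - rho *: nu)) = t + rho.
  apply/eqP; rewrite eq_le; apply/andP; split; last first.
    by have := up x Ox; rewrite lerBrDr.
  rewrite opprB addrCA addrC; apply: le_trans (enormD _ _) _.
  by rewrite -xy enormZ nu1 mulr1 gtr0_norm.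
have an : dotp (x - y) nu = t.
  have : dotp (x - (y - rho *: nu)) (x - (y - rho *: nu)) = (t + rho) ^+ 2.
    by rewrite -sqr_enorm E1.
  have -> : x - (y - rho *: nu) = (x - y) + rho *: nu by rewrite opprB addrCA addrC.
  move: (x - y) aa => a aa; rewrite !dotpE (dotpC nu) aa nn => H.
  have : 2 * rho * dotp a nu = 2 * rho * t by lra.
  by apply: mulfI; rewrite mulf_neq0 ?gt_eqF.
have E2 : x - y = t *: nu.
  apply/eqP; rewrite -subr_eq0; apply/eqP/enorm_eq0/eqP.
  rewrite -sqrf_eq0 sqr_enorm; apply/eqP.
  by move: (x - y) aa an => a aa an; rewrite !dotpE (dotpC nu) aa an nn; ring.
split => //; last by move=> w; exact: distG_ge_interior.
by rewrite opprD addrA E2 -scalerBl enormZ nu1 mulr1 ltr0_norm ?opprB // subr_lt0.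
Qed.

End DistanceToBoundary.

(** * Second derivatives of the distance *)

Section TaylorBounds.
Context {R : realType} {N : nat}.
Notation V := 'rV[R]_N.
Implicit Types (x y v : V) (f : V -> R) (i j : 'I_N).

Lemma nbhs_all (x : V) (P : 'I_N -> V -> Prop) :
  (forall i, nbhs x (P i)) -> nbhs x (fun y => forall i, P i y).
Proof. move=> H; exact: (@filter_forall V 'I_N P (nbhs x) (nbhs_filter x) H). Qed.

Lemma le_sum2 (a : 'I_N -> 'I_N -> R) i j : (forall k l, 0 <= a k l) ->
  a i j <= \sum_k \sum_l a k l.
Proof.
move=> a0; rewrite (bigD1 i) //= (bigD1 j) //= -addrA lerDl.
rewrite addr_ge0 // sumr_ge0 // => k _; exact: sumr_ge0.
Qed.

Lemma Ck2_bounded (U : set V) f x : open U -> U x -> Ck 2 U f ->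
  exists r B : R, [/\ 0 < r, 0 < B & forall y, `|x - y| < r ->
    U y /\ forall i j, `|partial j (partial i f) y| <= B].
Proof.
move=> oU Ux [_ c2f].
set B : R := 1 + \sum_i \sum_j (`|partial j (partial i f) x| + 1).
have Bij i j : `|partial j (partial i f) x| + 1 <= B.
  apply: le_trans (_ : \sum_i \sum_j (`|partial j (partial i f) x| + 1) <= _).
    by apply: (@le_sum2 (fun i j => `|partial j (partial i f) x| + 1)) => k l; rewrite addr_ge0.
  by rewrite /B lerDr ler01.
have H : nbhs x (fun y => forall i j, `|partial j (partial i f) y| <= B).
  apply: nbhs_all => i; apply: nbhs_all => j.
  have [r r0 Hr] := cont_rV_dist ((c2f i).2 j x Ux) (@ltr01 R).
  apply/nbhs_ballP; exists r => // y; rewrite -ball_normE => /Hr.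
  rewrite distrC => h; apply: le_trans (Bij i j).
  have -> : partial j (partial i f) y = partial j (partial i f) x
     + (partial j (partial i f) y - partial j (partial i f) x) by rewrite addrC subrK.
  by apply: le_trans (ler_normD _ _) _; rewrite lerD2l ltW.
have [r r0 Hr] := nbhs_rV_ball (filterI (open_nbhs_nbhs (conj oU Ux)) H).
exists r, B; split => //.
rewrite ltr_wpDr // ; apply: sumr_ge0 => i _; apply: sumr_ge0 => j _.
by rewrite addr_ge0.
Qed.

Lemma partial_increment (U : set V) f y v c B i : 0 < c -> Ck 2 U f ->
  (forall t : R, 0 <= t <= c -> U (y + t *: v) /\
     forall j, `|partial j (partial i f) (y + t *: v)| <= B) ->
  `|partial i f (y + c *: v) - partial i f y| <= c * (N%:R * (enorm v * B)).
Proof.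
move=> c0 [_ c2f] H.
have [|c' /andP[c'0 c'c] ->] := @MVT_line _ _ (partial i f) v y c c0.
  by move=> t /H [Ut _]; apply/diff_derivable/(c2f i).1.
have /H [Uc Hc] : 0 <= c' <= c by rewrite !ltW.
rewrite normrM gtr0_norm // ler_wpM2l ?(ltW c0) //.
rewrite derive_lincomb; last exact: (c2f i).1.
apply: le_trans (ler_norm_sum _ _ _) _.
have -> : N%:R * (enorm v * B) = \sum_(j < N) enorm v * B.
  by rewrite sumr_const card_ord mulr_natl.
apply: ler_sum => j _; rewrite normrM; apply: ler_pM => //.
exact: coord_le_enorm.
Qed.

(** The mean value theorem is applied to [f] along [v] and then to each partial derivative. The
    factor [N%:R ^+ 2] is not sharp; it only affects the radius of the touching balls. *)
Lemma taylor1 (U : set V) f y v B : Ck 2 U f ->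
  (forall t : R, 0 <= t <= 1 -> U (y + t *: v) /\
     forall i j, `|partial j (partial i f) (y + t *: v)| <= B) ->
  `|f (y + v) - f y - dotp (grad f y) v| <= N%:R ^+ 2 * B * dotp v v.
Proof.
move=> cf H.
have [|c /andP[c0 c1]] := @MVT_line _ _ f v y 1 ltr01.
  by move=> t /H [Ut _]; exact/diff_derivable/cf.1.
rewrite scale1r mul1r => ->.
have /H [Uc _] : 0 <= c <= 1 by rewrite !ltW.
rewrite derive_lincomb; last exact: cf.1.
rewrite /dotp -sumrB; apply: le_trans (ler_norm_sum _ _ _) _.
rewrite -/(dotp v v) -sqr_enorm.
have -> : N%:R ^+ 2 * B * enorm v ^+ 2 = \sum_(i < N) enorm v * (N%:R * (enorm v * B)).
  by rewrite sumr_const card_ord -[RHS]mulr_natl; ring.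
apply: ler_sum => i _; rewrite mxE mulrC -mulrBl normrM mulrC.
apply: ler_pM => //; first exact: coord_le_enorm.
apply: le_trans (_ : c * (N%:R * (enorm v * B)) <= _).
  apply: (partial_increment c0 cf) => t /andP[t0 tc].
  have [|Ut K] := H t; first by rewrite t0 (le_trans tc) // ltW.
  by split => // j; exact: K.
rewrite ler_piMl ?(ltW c1) // !mulr_ge0 ?enorm_ge0 //.
have [/H [_ K]] : 0 <= (0 : R) <= 1 by rewrite lexx ler01.
by apply: le_trans (K i i).
Qed.

(* [k] is meant to be [1] or [-1]: the lower bound is the upper bound for [- f],
   whose iterated partial derivatives would be awkward off [U]. *)
Lemma second_derivative_ub (U : set V) f x v (k A C : R) : open U -> Ck 2 U f -> U x ->
  (exists2 d : R, 0 < d & forall h, `|h| < d ->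
     k * f (x + h *: v) <= k * f x + h * A + h ^+ 2 * C) ->
  k * (\sum_i \sum_j v 0 i * v 0 j * partial j (partial i f) x) <= 2 * C.
Proof.
move=> oU cf Ux [d d0 H].
pose D2 (y : V) : R := k * (\sum_i \sum_j v 0 i * v 0 j * partial j (partial i f) y).
pose D1 (w y : V) : R := k * (\sum_i w 0 i * partial i f y).
rewrite leNgt; apply/negP => gap.
have cD2 : {for x, continuous D2}.
  apply: cont_mul; first exact: (@cst_continuous V R _ x).
  apply: cont_sum => i; apply: cont_sum => j.
  apply: cont_mul; first exact: (@cst_continuous V R _ x).
  exact: (cf.2 i).2.
have gap0 : 0 < D2 x - 2 * C by rewrite subr_gt0.
have [r r0 Hr] := cont_rV_dist cD2 gap0.
have [r' r'0 Hr'] := open_rV_ball oU Ux.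
have [L L0 vL] : exists2 L : R, 0 < L & `|v| <= L.
  by exists (`|v| + 1); [rewrite ltr_wpDl|rewrite lerDl].
have [m [m0 mr mr']] : exists m : R, [/\ 0 < m, m <= r & m <= r'].
  by exists (Num.min r r'); rewrite lt_min r0 r'0 !ge_min !lexx orbT.
have [h [h0 hd hL]] : exists h : R, [/\ 0 < h, h < d & h * L < m].
  have q0 : 0 < Num.min d (m / L) by rewrite lt_min d0 divr_gt0.
  exists (Num.min d (m / L) / 2).
  have : Num.min d (m / L) / 2 < Num.min d (m / L).
    by rewrite gtr_pMr ?invf_lt1 ?ltr1n.
  by rewrite lt_min ltr_pdivlMr // => /andP[-> ->]; rewrite divr_gt0.
have near_x t : `|t| <= h -> U (x + t *: v) /\ 2 * C < D2 (x + t *: v).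
  move=> th.
  have xt : `|x - (x + t *: v)| < m.
    rewrite opprD addNKr normrN normrZ; apply: le_lt_trans hL.
    exact: ler_pM.
  split; first by apply: Hr'; exact: lt_le_trans mr'.
  have := Hr _ (lt_le_trans xt mr).
   by rewrite ltr_norml => /andP[_]; rewrite ltrD2l ltrN2.
have dD1 w t : `|t| <= h -> is_derive (x + t *: v) v (D1 w)
    (k * (\sum_i w 0 i * \sum_j v 0 j * partial j (partial i f) (x + t *: v))).
  move=> /near_x [Ut _]; apply: is_derive_cstM; apply: is_derive_sumf => i; apply: is_derive_cstM.
  rewrite -derive_lincomb; last exact: (cf.2 i).1.
  exact/derivableP/diff_derivable/(cf.2 i).1.
have D2E y : D2 y = k * (\sum_i v 0 i * \sum_j v 0 j * partial j (partial i f) y).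
  by congr (_ * _); apply: eq_bigr => i _; rewrite mulr_sumr; apply: eq_bigr => j _; rewrite mulrA.
have dl (w y : V) : U y -> is_derive y w (fun z => k * f z) (D1 w y).
  move=> Uy; have := @derivableP _ _ _ f y w (diff_derivable (cf.1 y Uy)).
  move=> H1; apply: (is_derive_eq (is_derive_cstM k H1)).
  by rewrite derive_lincomb //; exact: cf.1.
(* Symmetrised increment. Adding the hypothesis at [h] and [- h] cancels the linear terms and gives
   [K h <= K 0], whereas a second derivative above [2 * C] near [x] would make [K] increase. *)
pose K t := k * f (x + t *: v) + k * f (x + t *: (- v)) - 2 * C * (t * t).
have dk t : 0 <= t <= h -> is_derive t (1 : R) K
   (D1 v (x + t *: v) + D1 (- v) (x + t *: (- v)) - 2 * C * (t * 1 + t * 1)).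
  move=> /andP[t0 th].
  have th1 : `|t| <= h by rewrite ger0_norm.
  have th2 : `|- t| <= h by rewrite normrN.
  have [U1 _] := near_x _ th1; have [U2 _] := near_x _ th2.
  rewrite scaleNr -scalerN in U2.
  have id1 := is_derive_id t (1 : R).
  exact: (is_deriveBf (is_deriveDf (is_derive_line (dl _ _ U1)) (is_derive_line (dl _ _ U2)))
    (is_derive_cstM (2 * C) (is_deriveMf id1 id1))).
have th' (t : R) : t \in `]0, h[%R -> 0 <= t <= h.
  by rewrite in_itv /= => /andP[/ltW -> /ltW ->].
have dk' (t : R) th := dk t (th' t th).
have [|c] := @MVT R K _ 0 h h0 dk'.
  apply: derivable_within_continuous => t; rewrite in_itv /= => th.
  by have [] := dk t th.
rewrite in_itv /= => /andP[c0 ch] E.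
have kh : K h <= K 0.
  rewrite /K !scale0r !addr0 mulr0 mulr0 subr0.
  have h1 : `|h| < d by rewrite gtr0_norm.
  have h2 : `|- h| < d by rewrite normrN.
  have := H _ h1; have := H _ h2; rewrite scaleNr -scalerN sqrrN.
  rewrite -expr2; move: (k * f _) (k * f _) (k * f _) (h ^+ 2) => p q s z; lra.
have := kh; rewrite -subr_le0 E subr0 pmulr_lle0 //; apply/negP; rewrite -ltNge.
have E1 : D1 (- v) (x + c *: - v) = - D1 v (x - c *: v).
  rewrite /D1 -mulrN -sumrN scalerN; congr (_ * _); apply: eq_bigr => i _.
  by rewrite mxE mulNr.
rewrite E1.
have cc0 : 0 < c + c by rewrite addr_gt0.
have inh t : 0 <= t <= c + c -> `|t - c| <= h.
  by move=> /andP[t0 tc]; rewrite ler_norml; apply/andP; split; lra.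
have shift t : x - c *: v + t *: v = x + (t - c) *: v by rewrite scalerBl [LHS]addrAC -addrA.
have [|c' /andP[c'0 c'c]] := @MVT_line _ _ (D1 v) v (x - c *: v) (c + c) cc0.
  by move=> t /inh th; rewrite shift; have [] := dD1 v _ th.
rewrite !shift addrK => E2.
have th : `|c' - c| <= h by apply: inh; rewrite !ltW.
rewrite (derive_val (is_derive := dD1 v _ th)) -D2E in E2.
rewrite E2 mulr1; have [_] := near_x _ th; move: (D2 _) => z zC.
rewrite [X in 0 < X](_ : _ = (c + c) * (z - 2 * C)); last by ring.
by apply: (mulr_gt0 cc0); rewrite subr_gt0.
Qed.

End TaylorBounds.

(** * Uniform touching balls and the bound on the Hessian *)

Section HessianOfDistance.
Context {R : realType} {N : nat}.
Notation V := 'rV[R]_N.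
Implicit Types (x y v w : V) (f : V -> R) (i j : 'I_N) (rho : R).

Lemma Ck_weaken k (U : set V) f : Ck k.+1 U f -> Ck k U f.
Proof.
elim: k f => [|k IH] f /= [df H]; last by split => // i; exact: IH.
by move=> x Ux; apply/differentiable_continuous/df.
Qed.

Lemma Ck_sub k (U W : set V) f : W `<=` U -> Ck k U f -> Ck k W f.
Proof.
move=> WU; elim: k f => [|k IH] f /=; first by move=> H x /WU; exact: H.
by move=> [df H]; split => [x /WU|i]; [exact: df|exact: IH].
Qed.

Lemma in_ball_dotp n v rho : 0 < rho -> enorm n = 1 -> enorm (v - rho *: n) < rho ->
  enorm v < 2 * rho /\ dotp v v < 2 * rho * dotp n v.
Proof.
move=> rho0 n1 H; split.
  have -> : v = (v - rho *: n) + rho *: n by rewrite subrK.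
  apply: le_lt_trans (enormD _ _) _; rewrite enormZ n1 mulr1 gtr0_norm //.
  by rewrite mulr_natl mulr2n ltrD2r.
have : enorm (v - rho *: n) ^+ 2 < rho ^+ 2.
  by rewrite ltr_pXn2r ?nnegrE ?enorm_ge0 // ltW.
rewrite sqr_enorm !dotpE (dotpC v n) -(sqr_enorm n) n1.
move: (dotp v v) (dotp n v) => p q; rewrite expr1n mulr1 expr2 mulrN => K.
by rewrite -mulrA; move: (rho * q) (rho * rho) K => c d K; lra.
Qed.

Variable Omega : set V.
Hypotheses (oO : open Omega) (bO : bounded_set Omega) (B0 : bdry Omega !=set0).
Hypothesis C3 : C3_boundary Omega.

(** At a boundary point the defining function is its linear part up to [M * dotp v v]. In a ball of
    radius [rho] tangent at [v = 0] with unit axis [n], [dotp v v < 2 * rho * dotp n v], so for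
    small [rho] the linear part fixes the sign. *)
Lemma local_two_sided_ball y0 : bdry Omega y0 -> exists r rho0 : R,
  [/\ 0 < r, 0 < rho0 & forall y rho, `|y0 - y| < r -> bdry Omega y ->
    0 < rho < rho0 -> two_sided_ball Omega rho y].
Proof.
move=> By0; have [U [phi [oU Uy0 c3 gphi Ophi]]] := C3 By0.
have c2 : Ck 2 U phi := Ck_weaken c3.
have [r1 [B [r10 B00 HB]]] := Ck2_bounded oU Uy0 c2.
have [i0 pi0] : exists i, partial i phi y0 != 0.
  apply: contrapT => /forallNP H; move: (gphi y0 Uy0); apply/negP; rewrite negbK.
  apply/eqP/rowP => i; rewrite !mxE; apply/eqP; apply: contrapT => /negP; exact: H.
have m0 : 0 < `|partial i0 phi y0| / 2 by rewrite divr_gt0 // normr_gt0.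
set m := _ / 2 in m0.
have [r2 r20 Hr2] := cont_rV_dist (differentiable_continuous ((c2.2 i0).1 y0 Uy0)) m0.
have [r [r0 rr1 rr2]] : exists r : R, [/\ 0 < r, r + r <= r1 & r <= r2].
  exists (Num.min (r1 / 2) r2); rewrite lt_min divr_gt0 // r20 ge_min lexx orbT; split => //.
  have : Num.min (r1 / 2) r2 <= r1 / 2 by rewrite ge_min lexx.
  by move: (Num.min _ _) => z; lra.
pose M := N%:R ^+ 2 * B + 1.
have M0 : 0 < M by rewrite ltr_wpDl // mulr_ge0 ?sqr_ge0 // ltW.
(* With [rho < r / 2], displacements shorter than [2 * rho] stay where the second derivatives are
   bounded; [2 * M * rho < m] lets the gradient, of norm at least [m] near [y0], dominate the
   quadratic error. *)
exists r, (Num.min (r / 2) (m / (2 * M))); split => //.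
  by rewrite lt_min; apply/andP; split; apply: divr_gt0 => //; exact: mulr_gt0.
move=> y rho yr By /andP[rho0]; rewrite lt_min => /andP[].
rewrite ltr_pdivlMr // ltr_pdivlMr ?mulr_gt0 // => rhor rhom.
have Uy : U y by have [] := HB y (lt_le_trans yr (le_trans _ rr1)); rewrite ?lerDl ?(ltW r0).
have py0 : phi y = 0.
  have [cy nOy] := By; apply/eqP; rewrite eq_le; apply/andP; split; last first.
    by rewrite leNgt; apply/negP => /(Ophi y Uy).2.
  rewrite leNgt; apply/negP => py.
  have [e e0 He] := cont_rV_dist (differentiable_continuous (c2.1 y Uy)) py.
  have [e' e'0 He'] := open_rV_ball oU Uy.
  have ee : 0 < Num.min e e' by rewrite lt_min e0.
  have [z [Oz]] := cy _ (nbhsx_ballx y _ ee).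
  rewrite -ball_normE /= lt_min => /andP[/He K /He' Uz].
  have := (Ophi z Uz).1 Oz; move: K; rewrite ltr_norml => /andP[_].
  by rewrite ltrBlDl ltrDr => pz /(lt_trans pz); rewrite ltxx.
set g := grad phi y.
have gm : m <= enorm g.
  apply: le_trans (coord_le_enorm g i0); rewrite mxE.
  have := Hr2 y (lt_le_trans yr rr2).
  have := ler_normD (partial i0 phi y0 - partial i0 phi y) (partial i0 phi y).
  have -> : `|partial i0 phi y0 - partial i0 phi y + partial i0 phi y| = m + m.
    by rewrite subrK /m -splitr.
  by move=> H1 H2; rewrite -(lerD2l m); apply: le_trans H1 _; rewrite lerD2r ltW.
have g0 : 0 < enorm g := lt_le_trans m0 gm.
have main v : enorm v < 2 * rho -> U (y + v) /\ `|phi (y + v) - dotp g v| <= M * dotp v v.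
  move=> v2.
  have inb t : 0 <= t <= 1 -> `|y0 - (y + t *: v)| < r1.
    move=> /andP[t0 t1]; apply: lt_le_trans rr1.
    rewrite opprD addrA; apply: le_lt_trans (ler_normB _ _) _; apply: ltrD => //.
    rewrite normrZ ger0_norm //; apply: le_lt_trans (_ : `|v| < _).
      by rewrite ler_piMl.
    apply: le_lt_trans (norm_le_enorm v) _; apply: lt_trans v2 _.
    by rewrite mulrC.
  split; first by have [] := HB _ (inb 1 _); rewrite ?scale1r ?lexx ?ler01.
  have := @taylor1 _ _ U phi y v B c2 (fun t th => HB _ (inb t th)).
  rewrite py0 subr0 => /le_trans; apply.
  by rewrite ler_wpM2r ?dotp_ge0 // /M lerDl.
pose nu := - ((enorm g)^-1 *: g).
have nu1 : enorm nu = 1.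
  by rewrite enormN enormZ ger0_norm ?invr_ge0 ?(ltW g0) // mulVf ?gt_eqF.
have gnu v : dotp g v = - (enorm g * dotp nu v).
  by rewrite /nu dotpNl dotpZl mulrN opprK mulrA mulfV ?gt_eqF // mul1r.
have key v n : enorm n = 1 -> enorm (v - rho *: n) < rho ->
    enorm v < 2 * rho /\ M * dotp v v < enorm g * dotp n v.
  move=> n1 /(in_ball_dotp rho0 n1) [v2 vv]; split => //.
  have nv : 0 < dotp n v.
    have : 0 < 2 * rho * dotp n v := le_lt_trans (dotp_ge0 v) vv.
    by rewrite pmulr_rgt0 // mulr_gt0.
  apply: lt_le_trans (_ : m * dotp n v <= _); last by rewrite ler_wpM2r // ltW.
  apply: lt_trans (_ : M * (2 * rho * dotp n v) < _); first by rewrite ltr_pM2l.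
  by rewrite mulrA ltr_pM2r // (_ : M * (2 * rho) = rho * (2 * M)) //; ring.
exists nu => //; split => w wb.
  have := key (w - y) nu nu1; rewrite -addrA -opprD => /(_ wb) [v2 lt].
  have [] := main _ v2; rewrite addrC subrK => Uw.
  rewrite gnu opprK ler_norml => /andP[_ K]; apply/(Ophi w Uw).
  by move: (phi w) (M * _) (enorm g * _) K lt => a b c; lra.
have := key (w - y) (- nu); rewrite enormN scalerN -addrA -opprD => /(_ nu1 wb) [v2 lt].
have [] := main _ v2; rewrite addrC subrK => Uw.
rewrite gnu opprK ler_norml => /andP[K _] /(Ophi w Uw).
move: lt; rewrite dotpNl mulrN.
by move: (phi w) (M * _) (enorm g * _) K => a b c; lra.
Qed.

Lemma uniform_two_sided_ball :
  exists2 rho, 0 < rho & forall y, bdry Omega y -> two_sided_ball Omega rho y.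
Proof.
have /compact_near_coveringP := bdry_compact oO bO.
move=> /(_ R (nbhs (0 : R)^'+) (fun rho y => bdry Omega y -> two_sided_ball Omega rho y)).
case.
  move=> y0 By0; have [r [rho0 [r0 rho00 H]]] := local_two_sided_ball By0.
  exists ([set y | `|y0 - y| < r], [set rho | 0 < rho < rho0]).
    split => /=.
      have -> : [set y | `|y0 - y| < r] = ball y0 r by rewrite -ball_normE.
      exact: nbhsx_ballx.
    suff : \forall rho \near (0 : R)^'+, 0 < rho < rho0 by [].
    near=> rho; apply/andP; split; near: rho; first exact: nbhs_right_gt.
    exact: nbhs_right_lt.
  by move=> [y rho] /= [yr rhob] By; exact: H.
move=> d0 /= d00 H.
exists (d0 / 2); first by rewrite divr_gt0.
move=> y By; apply: (H (d0 / 2)) => //=; last by rewrite divr_gt0.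
rewrite /ball_ /= sub0r normrN gtr0_norm ?divr_gt0 //.
by rewrite ltr_pdivrMr // ltr_pMr // ltr1n.
Unshelve. all: by end_near. Qed.

(** Second derivatives of the two comparison functions at [x] are controlled by the inverse
    distances to the centres, [rho + distG Omega x] and [rho - distG Omega x]. Both distances are at
    least [rho / 2], whence [2 / rho]. *)
Lemma hessian_distG_bound rho (s : R) x v : 0 < rho ->
  (forall y, bdry Omega y -> two_sided_ball Omega rho y) ->
  Ck 2 (strip Omega s) (distG Omega) -> strip Omega s x -> distG Omega x <= rho / 2 ->
  `|\sum_i \sum_j v 0 i * v 0 j * partial j (partial i (distG Omega)) x|
    <= 2 / rho * dotp v v.
Proof.
move=> rho0 balls cd sx xrho; have [Ox _] := sx.
have xrho' : distG Omega x < rho by lra.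
have d0 : 0 < distG Omega x := distG_gt0 oO bO B0 Ox.
have [z1 [z2 [E1 E2 up lo]]] := touching_balls oO bO B0 rho0 balls Ox xrho'.
have oS := strip_open oO bO B0 (s := s).
have [r r0 Hr] := open_rV_ball oO Ox.
have [d d1 inO] : exists2 d : R, 0 < d & forall h, `|h| < d -> Omega (x + h *: v).
  have L0 : 0 < `|v| + 1 by rewrite ltr_wpDl.
  exists (r / (`|v| + 1)); first by rewrite divr_gt0.
  move=> h; rewrite ltr_pdivlMr // => hr; apply: Hr.
  rewrite opprD addNKr normrN normrZ; apply: le_lt_trans hr.
  by rewrite ler_wpM2l // lerDl.
have vv := dotp_ge0 v.
set S := \sum_i _; set t := distG Omega x in E1 E2 d0 xrho xrho' *.
rewrite ler_norml; apply/andP; split.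
- have p0 : 0 < enorm (x - z2) by rewrite E2 subr_gt0.
  have := @second_derivative_ub R N (strip Omega s) (distG Omega) x v (-1)
    (dotp (x - z2) v / (rho - t)) (dotp v v / (2 * (rho - t))) oS cd sx.
  have -> : 2 * (dotp v v / (2 * (rho - t))) = dotp v v / (rho - t).
    by field; rewrite subr_eq0 gt_eqF.
  have le1 : dotp v v / (rho - t) <= 2 / rho * dotp v v.
    rewrite mulrC ler_wpM2r // -(invf_div rho 2) lef_pV2 ?posrE ?subr_gt0 ?divr_gt0 //.
    by lra.
  move=> H; have {}H : - 1 * S <= dotp v v / (rho - t).
    apply: H; exists d => // h hd; have := lo (x + h *: v); rewrite (addrAC x).
    have := enorm_shift_le v h p0; rewrite E2 !mulN1r -/t.
    move: (enorm _) (h * (_ / _)) (h ^+ 2 * _) (distG Omega _) => a b c e; lra.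
  by move: H le1; rewrite mulN1r; move: (dotp v v / _) (2 / rho * _) => a b; lra.
- have p0 : 0 < enorm (x - z1) by rewrite E1 addr_gt0.
  have := @second_derivative_ub R N (strip Omega s) (distG Omega) x v 1
    (dotp (x - z1) v / (t + rho)) (dotp v v / (2 * (t + rho))) oS cd sx.
  have -> : 2 * (dotp v v / (2 * (t + rho))) = dotp v v / (t + rho).
    by field; rewrite gt_eqF // addr_gt0.
  have le1 : dotp v v / (t + rho) <= 2 / rho * dotp v v.
    rewrite mulrC ler_wpM2r // -(invf_div rho 2) lef_pV2 ?posrE ?addr_gt0 ?divr_gt0 //.
    by lra.
  rewrite !mul1r => H; apply: le_trans le1; apply: H; exists d => // h hd.
  have := up _ (inO h hd); rewrite (addrAC x); have := enorm_shift_le v h p0.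
  rewrite E1 -/t.
  move: (enorm _) (h * (_ / _)) (h ^+ 2 * _) (distG Omega _) => a b c e; lra.
Qed.

End HessianOfDistance.

(** * The estimate on a strip *)

Section StripCutoffs.
Context {R : realType}.
Implicit Types (P Q : R -> R) (a l r s : R).

Definition rescale a l r : R := clamp ((r - a) / l).

Lemma rescale_is_derive P Q a l r : (forall t : R, is_derive t (1 : R) P (Q t)) ->
  P 0 = 0 -> P 1 = 0 -> Q 0 = 0 -> Q 1 = 0 ->
  is_derive r (1 : R) (fun t : R => P (rescale a l t)) (Q (rescale a l r) / l).
Proof.
move=> dP P0 P1 Q0 Q1.
have H := clamp_is_derive dP P0 P1 Q0 Q1 ((r - a) / l).
have A : is_derive r (1 : R) (fun t : R => (t - a) / l) l^-1.
  rewrite (_ : (fun t : R => _) = (fun t : R => - (a / l) + l^-1 * t)).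
    exact: is_derive_affine.
  by apply/funext => t; ring.
apply: (@is_derive_compf _ _ (fun t => P (clamp t)) (fun t : R => (t - a) / l)) => //.
by apply/differentiable_continuous/derivable1_diffP; have [] := A.
Qed.

Lemma rescale_continuous P a l : continuous P -> continuous (fun t : R => P (rescale a l t)).
Proof.
move=> cP t; apply: (@continuous_comp _ _ _ (rescale a l) P); last exact: cP.
apply: (@continuous_comp _ _ _ (fun t : R => (t - a) / l) clamp); last exact: clamp_continuous.
by apply: cvgMl; apply: cvgB; [exact: cvg_id|exact: cvg_cst].
Qed.

Lemma rescale_out P a l r : 0 < l -> P 0 = 0 -> P 1 = 0 -> ~~ (a <= r <= a + l) ->
  P (rescale a l r) = 0.
Proof.
move=> l0 P0 P1 H; apply: clamp_out => //; apply: contra H.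
by rewrite ler_pdivlMr // mul0r subr_ge0 ler_pdivrMr // mul1r lerBlDl.
Qed.

Lemma rescale_in a l r : 0 < l -> a <= r <= a + l -> rescale a l r = (r - a) / l.
Proof.
move=> l0 H; rewrite /rescale; case: (clampP ((r - a) / l)) => _ _ [[_ ->//]|[K ->]|[K ->]].
  apply/esym/eqP; rewrite eq_le K divr_ge0 ?(ltW l0) // subr_ge0.
  by case/andP: H.
apply/esym/eqP; rewrite eq_le K andbT ler_pdivrMr // mul1r lerBlDl.
by case/andP: H.
Qed.

Lemma rescale01 a l r : 0 <= rescale a l r <= 1.
Proof. by rewrite /rescale; have [-> -> _] := clampP ((r - a) / l). Qed.

(* Exhaustion of [0 < r < s] by continuous cutoffs, increasing in [n]; [window s n]
   vanishes where [r (s - r) <= s^2 / (n + 20)]. *)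
Definition window s n r : R := clamp ((n + 20)%:R * (r * (s - r) / s ^+ 2) - 1).

Lemma window01 s n r : 0 <= window s n r <= 1.
Proof. by rewrite /window; have [-> -> _] := clampP ((n + 20)%:R * (r * (s - r) / s ^+ 2) - 1). Qed.

Lemma clamp_mono (x y : R) : x <= y -> clamp x <= clamp y.
Proof.
move=> xy; case: (clampP x) (clampP y) => [x0 x1 Hx] [y0 y1 Hy].
case: Hx => [[/andP[p q] Hx]|[p Hx]|[p Hx]]; rewrite Hx //;
  case: Hy => [[/andP[p' q'] Hy]|[p' Hy]|[p' Hy]]; rewrite Hy //; lra.
Qed.

Lemma window_homo s r : 0 < s -> 0 < r < s ->
  {homo (fun n => window s n r) : m n / (m <= n)%N >-> m <= n}.
Proof.
move=> s0 /andP[r0 rs] m n mn; apply: clamp_mono; rewrite lerD2r ler_wpM2r ?ler_nat ?leq_add2r //.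
by rewrite divr_ge0 ?sqr_ge0 // mulr_ge0 ?(ltW r0) // subr_ge0 ltW.
Qed.

Lemma window_continuous s n : continuous (window s n).
Proof.
move=> t; apply: (@continuous_comp _ _ _ (fun r : R => (n + 20)%:R * (r * (s - r) / s ^+ 2) - 1) clamp);
  last exact: clamp_continuous.
have cid : {for t, continuous (fun r : R => r)} by exact: cvg_id.
have k c : {for t, continuous (fun _ : R => c : R)} by exact: (@cst_continuous R R c t).
exact: (cont_sub (cont_mul (k _) (cont_mul (cont_mul cid (cont_sub (k s) cid)) (k _))) (k 1)).
Qed.

Lemma window_out s n r : 0 < s -> 0 < r < s ->
  ~~ (s / (n + 20)%:R <= r <= s - s / (n + 20)%:R) -> window s n r = 0.
Proof.
move=> s0 /andP[r0 rs] H; rewrite /window.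
have n0 : 0 < (n + 20)%:R :> R by rewrite ltr0n addnS.
have [h|h] := leP ((n + 20)%:R * (r * (s - r) / s ^+ 2)) 1.
  have h' : (n + 20)%:R * (r * (s - r) / s ^+ 2) - 1 <= 0 by rewrite subr_le0.
  by case: (clampP ((n + 20)%:R * (r * (s - r) / s ^+ 2) - 1)) => _ _ [[/andP[K _] ->]|[_ ->]|[K _]] //; lra.
exfalso; move/negP: H; apply.
have s20 : 0 < s ^+ 2 by rewrite exprn_gt0.
have K : s ^+ 2 < (n + 20)%:R * (r * (s - r)).
  by move: h; rewrite mulrA ltr_pdivlMr // mul1r.
apply/andP; split.
  rewrite ler_pdivrMr // -(ler_pM2r s0) -expr2; apply/ltW/(lt_le_trans K).
  rewrite (mulrC _ (r * _)) mulrAC -subr_ge0.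
  rewrite (_ : _ - _ = r * r * (n + 20)%:R); last by ring.
  by rewrite !mulr_ge0 // ltW.
rewrite lerBrDr -lerBrDl ler_pdivrMr // -(ler_pM2r s0) -expr2; apply/ltW/(lt_le_trans K).
rewrite -subr_ge0 (_ : _ - _ = (s - r) * (s - r) * (n + 20)%:R); last by ring.
by rewrite !mulr_ge0 ?subr_ge0 // ltW.
Qed.

(** The new index satisfies 8 n + 140 + 20 = 8 (n + 20). With a = s / (n + 20) / 2, the product r (s
    - r) is at least a (s - a) >= a s / 2, so the scaled quotient reaches 2 and [clamp]
    saturates. *)
Lemma window_in s n r : 0 < s ->
  s / (n + 20)%:R / 2 <= r <= s - s / (n + 20)%:R / 2 -> window s (8 * n + 140) r = 1.
Proof.
move=> s0 /andP[h1 h2]; rewrite /window.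
have n0 : 0 < (n + 20)%:R :> R by rewrite ltr0n addnS.
have -> : (8 * n + 140 + 20)%:R = 8 * (n + 20)%:R :> R.
  by rewrite -natrM; congr (_%:R); rewrite mulnDr -addnA.
have s20 : 0 < s ^+ 2 by rewrite exprn_gt0.
have a1 : (1 : R) <= (n + 20)%:R by rewrite ler1n addnS.
set z := (n + 20)%:R in n0 a1 h1 h2 *.
suff K : 2 <= 8 * z * (r * (s - r) / s ^+ 2).
  move: K; move: (8 * z * _) => w K.
  by case: (clampP (w - 1)) => _ _ [[/andP[_ q] ->]|[q _]|[_ ->]] //; lra.
pose a := s / z / 2.
have az : a * z = s / 2 by rewrite /a; field; rewrite gt_eqF.
have a0 : 0 < a by rewrite /a !divr_gt0.
have as2 : a <= s / 2 by rewrite -az ler_peMr // ltW.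
rewrite mulrA ler_pdivlMr //.
have K1 : a * (s - a) <= r * (s - r).
  rewrite -subr_ge0 (_ : _ - _ = (r - a) * (s - a - r)); last by ring.
  by rewrite mulr_ge0 // subr_ge0.
apply: le_trans (_ : 8 * z * (a * (s - a)) <= _); last first.
  by rewrite ler_wpM2l // mulr_ge0 // ltW.
rewrite (_ : 8 * z * (a * (s - a)) = 8 * (a * z) * (s - a)); last by ring.
rewrite az -subr_ge0 (_ : _ - _ = 4 * s * (s / 2 - a)); last by field.
by rewrite !mulr_ge0 ?subr_ge0 // ltW.
Qed.

Lemma window_cvg s r : 0 < s -> 0 < r < s -> window s n r @[n --> \oo] --> (1 : R).
Proof.
move=> s0 /andP[r0 rs].
have v0 : 0 < r * (s - r) / s ^+ 2 by rewrite divr_gt0 ?exprn_gt0 // mulr_gt0 // subr_gt0.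
set v := _ / _ in v0.
apply: cvg_near_cst.
have := nbhs_infty_ge (Num.truncn (2 / v)).+1; apply: filterS => n /= nn.
have K : 2 <= (n + 20)%:R * v.
  rewrite -ler_pdivrMr //; apply: le_trans (_ : n%:R <= _); last by rewrite ler_nat leq_addr.
  apply/ltW/(lt_le_trans (truncnS_gt _)); first by rewrite ler_nat.
rewrite /window -/v; move: ((n + 20)%:R * v) K => w K.
by case: (clampP (w - 1)) => _ _ [[/andP[_ q] ->]|[q _]|[_ ->]] //; lra.
Qed.

Lemma plateau_far k (w0 t : R) : 0 <= w0 -> `|1 - 2 * t| <= w0 -> w0 <= 1 ->
  1 - w0 ^+ k <= plateau k t.
Proof.
move=> w00 tw w1; rewrite /plateau lerD2l lerN2.
rewrite exprM -real_normK ?num_real // -exprM.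
apply: le_trans (_ : w0 ^+ (2 * k) <= _); first by rewrite lerXn2r ?nnegrE.
by apply: ler_wiXn2l => //; rewrite leq_pmull.
Qed.

End StripCutoffs.

(** * The pointwise inequality to be integrated *)

Section PointwiseBound.
Context {R : realType}.
Implicit Types (T D q ph et c h be e del : R).

(* The cutoff [W <= 1] lives where the plateau [et] exceeds [1 - del], del = (1 - be) / 2. *)
Lemma pointwise_bound T D q ph et c h hE be e W Cq k24 : 0 <= T -> 0 <= D ->
  0 <= ph -> 0 <= c <= 1 -> 0 <= et <= 1 -> 0 < be < 1 -> 0 <= e <= (1 - be) / 4 ->
  0 <= W <= 1 -> (W = 0 \/ 1 - (1 - be) / 2 <= et) ->
  h * hE <= e * et * (T + D) -> 0 <= k24 -> Cq / 2 <= k24 ->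
  be * (W * T) <= D + (k24 * q ^+ 2 + (1 + e)^-1 *
    (ph * (T + D) + (et - c * ph) * (T - D) - 2^-1 * q ^+ 2 * Cq - h * hE)).
Proof.
move=> T0 D0 ph0 /andP[c0 c1] /andP[et0 et1] /andP[be0 be1] /andP[e0 e1] /andP[W0 W1] HW HE k0 HC.
have e1p : 0 < 1 + e by rewrite ltr_wpDr.
(* The Hessian error raises the coefficient of [D] from [et] to [(1 + e) * et]; the factor
   [(1 + e)^-1] brings it back to at most 1. The sum of the nonnegative quantities below is what
   remains after clearing this factor. *)
rewrite -(ler_pM2l e1p) (mulrDr (1 + e) D) (mulrDr (1 + e) (k24 * _)).
rewrite mulVKf ?gt_eqF //.
have A1 : 0 <= (1 - c) * ph * T by rewrite !mulr_ge0 // subr_ge0.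
have A2 : 0 <= (1 + c) * ph * D by rewrite !mulr_ge0 // addr_ge0.
(* The tangential coefficient has dropped to [(1 - e) * et]; where [W] is not zero,
   [e <= (1 - be) / 4] keeps it above [(1 + e) * be]. *)
have A3 : (1 + e) * (be * (W * T)) <= (1 - e) * (et * T).
  rewrite !mulrA ler_wpM2r //; case: HW => [->|HW].
    by rewrite mulr0 mulr_ge0 //; lra.
  apply: le_trans (_ : (1 + e) * be <= _).
    by rewrite ler_piMr // mulr_ge0 // ltW.
  apply: le_trans (_ : (1 - e) * (1 - (1 - be) / 2) <= _); last first.
    by rewrite ler_wpM2l //; lra.
  have B1 : 0 <= (1 - be) / 4 - e by rewrite subr_ge0.
  have B2 : 0 <= ((1 - be) / 4 - e) * (be + (1 - (1 - be) / 2)).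
    by rewrite mulr_ge0 //; lra.
  have B3 : 0 <= (1 - be) ^+ 2 := sqr_ge0 _.
  rewrite -subr_ge0 (_ : _ - _ = ((1 - be) / 4 - e) * (be + (1 - (1 - be) / 2))
     + 3 / 8 * (1 - be) ^+ 2); last by field.
  by rewrite addr_ge0 // mulr_ge0 // divr_ge0.
have A4 : 0 <= (1 + e) * (1 - et) * D by rewrite !mulr_ge0 ?subr_ge0 // ltW.
have A5 : 0 <= (k24 - Cq / 2) * q ^+ 2 by rewrite mulr_ge0 ?sqr_ge0 // subr_ge0.
have A6 : 0 <= e * (k24 * q ^+ 2).
  by apply: mulr_ge0 => //; apply: mulr_ge0 => //; exact: sqr_ge0.
have A7 : 0 <= e * et * (T + D) - h * hE by rewrite subr_ge0.
apply: le_trans A3 _; rewrite -subr_ge0.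
rewrite (_ : _ - _ = (1 - c) * ph * T + (1 + c) * ph * D + (1 + e) * (1 - et) * D
  + (k24 - Cq / 2) * q ^+ 2 + e * (k24 * q ^+ 2) + (e * et * (T + D) - h * hE)).
  exact: addr_ge0 (addr_ge0 (addr_ge0 (addr_ge0 (addr_ge0 A1 A2) A4) A5) A6) A7.
by field.
Qed.

End PointwiseBound.

(** * Integrals over the strip as monotone limits of windowed integrals *)

Section IntegralOnStrip.
Context {R : realType} {N : nat}.
Notation V := 'rV[R]_N.
Implicit Types (x : V) (f g : V -> R).
Variable Omega : set V.
Hypotheses (oO : open Omega) (bO : bounded_set Omega) (B0 : bdry Omega !=set0).
Variable s : R.
Hypothesis s0 : 0 < s.
Let U := strip Omega s.
Let Phi := distG Omega.

Lemma strip_range x : U x -> 0 < Phi x < s.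
Proof. by move=> [Ox ->]; rewrite distG_gt0. Qed.

Definition annulus (a b : R) := [set x | Omega x /\ a <= Phi x <= b].

Lemma annulus_sub a b : b < s -> annulus a b `<=` U.
Proof. by move=> bs x [Ox /andP[_ xb]]; split => //; exact: le_lt_trans bs. Qed.

Lemma annulus_bounded a b : bounded_set (annulus a b).
Proof.
have [M [Mr H]] := bO; exists M; split => // M' MM' x [Ox _]; exact: H.
Qed.

Definition windowed n f : V -> R := zero_ext U (fun x => window s n (Phi x) * f x).

Lemma Ctail_windowed n f : (forall x, U x -> {for x, continuous f}) ->
  Ctail 0 (windowed n f).
Proof.
move=> cf.
have n0 : 0 < (n + 20)%:R :> R by rewrite ltr0n addnS.
have oU : open U by exact: strip_open.
have cK := @annulus_closed _ _ _ oO bO B0 (s / (n + 20)%:R) (s - s / (n + 20)%:R) (divr_gt0 s0 n0).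
apply: (@Ctail_zero_ext _ _ U (annulus (s / (n + 20)%:R) (s - s / (n + 20)%:R))) => //.
- exact: annulus_bounded.
- by apply: annulus_sub; rewrite gtrBl divr_gt0.
- move=> x Ux; apply: cont_mul; last exact: cf.
  apply: (@continuous_comp _ _ _ Phi (window s n)); last exact: window_continuous.
  exact: distG_cont.
- move=> x Ux Kx; rewrite window_out ?mul0r //; first exact: strip_range.
  by apply/negP => H; apply: Kx; split => //; case: Ux.
Qed.

Lemma windowed_homo f x : (forall y, U y -> 0 <= f y) ->
  {homo (fun n => windowed n f x) : m n / (m <= n)%N >-> m <= n}.
Proof.
move=> f0 m n mn; rewrite /windowed /zero_ext; case: asboolP => // Ux.
by rewrite ler_wpM2r ?f0 // window_homo // strip_range.
Qed.

Lemma windowed_ge0 n f x : (forall y, U y -> 0 <= f y) -> 0 <= windowed n f x.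
Proof.
move=> f0; rewrite /windowed /zero_ext; case: asboolP => // Ux.
by rewrite mulr_ge0 ?f0 //; have /andP[] := window01 s n (Phi x).
Qed.

Lemma integral_on_cvg f : (forall x, U x -> {for x, continuous f}) -> (forall x, U x -> 0 <= f x) ->
  (rint N (windowed n f) 0)%:E @[n --> \oo] --> integral_on U f.
Proof.
move=> cf f0; rewrite /integral_on /integral_RN.
apply: (@iint_monotone _ _ N (fun n => windowed n f)) => //.
- by move=> n; exact: Ctail_windowed.
- by move=> n x; exact: windowed_ge0.
- by move=> x; exact: windowed_homo.
- move=> x; rewrite /windowed /zero_ext; case: asboolP => Ux; last exact: cvg_cst.
  apply: cvg_EFin; first exact: nearW.
  rewrite /comp /= -[X in _ --> X]mul1r; apply: cvgMl; apply: window_cvg => //.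
  exact: strip_range.
Qed.

Lemma rint_windowed_le f n : (forall x, U x -> {for x, continuous f}) ->
  (forall x, U x -> 0 <= f x) -> ((rint N (windowed n f) 0)%:E <= integral_on U f)%E.
Proof.
move=> cf f0; have H := integral_on_cvg cf f0.
rewrite -(cvg_lim _ H) //; apply: lime_ge; first by apply/cvg_ex; exists (integral_on U f).
exists n => // m /= nm; rewrite lee_fin; apply: rint_le => //; try exact: Ctail_windowed.
by move=> x; exact: windowed_homo.
Qed.

Lemma integral_on_ge0 f : (forall x, U x -> 0 <= f x) -> (0 <= integral_on U f)%E.
Proof.
move=> f0; rewrite /integral_on /integral_RN.
have g0 (x : V) : (0 <= if `[< U x >] then (f x)%:E else 0)%E.
  by case: asboolP => // Ux; rewrite lee_fin f0.
suff H k (x : V) : (0 <= iint k (fun x => if `[< U x >] then (f x)%:E else 0%E) x)%E by [].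
by elim: k x => [|k IH] x //=; apply: integral_ge0.
Qed.

Lemma eq_integral_on f g : (forall x, U x -> f x = g x) -> integral_on U f = integral_on U g.
Proof.
move=> fg; congr (iint _ _ _); apply/funext => x.
by case: asboolP => // Ux; rewrite fg.
Qed.

(** Only the left side passes to the limit; each windowed integral on the right is already below its
    full integral. So the right window may be wider than the left one, and infinite values are
    allowed. *)
Lemma integral_on_le f g (h : V -> R) (b k : R) : 0 < b -> 0 <= k ->
  (forall x, U x -> {for x, continuous f}) -> (forall x, U x -> 0 <= f x) ->
  (forall x, U x -> {for x, continuous g}) -> (forall x, U x -> 0 <= g x) ->
  (forall x, U x -> {for x, continuous h}) -> (forall x, U x -> 0 <= h x) ->
  (forall n, exists m, b * rint N (windowed n f) 0 <=
     rint N (windowed m g) 0 + k * rint N (windowed m h) 0) ->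
  (b%:E * integral_on U f <= integral_on U g + k%:E * integral_on U h)%E.
Proof.
move=> b0 k0 cf f0 cg g0 ch h0 H.
have C : (b%:E * (rint N (windowed n f) 0)%:E)%E @[n --> \oo] --> (b%:E * integral_on U f)%E.
  by apply: cvgeZl => //; exact: integral_on_cvg.
rewrite -(cvg_lim _ C) //; apply: lime_le; first by apply/cvg_ex; eexists; exact: C.
apply: nearW => n; have [m Hm] := H n.
apply: le_trans (_ : (b * rint N (windowed n f) 0)%:E <= _)%E; first by rewrite EFinM.
apply: le_trans (_ : (rint N (windowed m g) 0 + k * rint N (windowed m h) 0)%:E <= _)%E.
  by rewrite lee_fin.
rewrite EFinD EFinM; apply: leeD; first exact: rint_windowed_le.
by apply: lee_wpmul2l; rewrite ?lee_fin //; exact: rint_windowed_le.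
Qed.

End IntegralOnStrip.

(** * The estimate at a fixed cutoff level *)

Section StripEstimate.
Context {R : realType} {N : nat}.
Notation V := 'rV[R]_N.
Implicit Types (x v : V) (i j : 'I_N).
Variable Omega : set V.
Hypotheses (oO : open Omega) (bO : bounded_set Omega) (B0 : bdry Omega !=set0).
Variables (s beta M : R) (p p0 : V -> R).
Let U := strip Omega s.
Let Phi := distG Omega.
Hypotheses (s0 : 0 < s) (beta01 : 0 < beta < 1) (M0 : 0 < M).
Hypothesis sM : 2 * s * ((2 + N%:R) * M) <= (1 - beta) / 4.
Hypothesis sNM : N%:R * M * s <= 1 / 25.
Hypotheses (cPhi : Ck 2 U Phi) (unitG : forall x, U x -> enorm (grad Phi x) = 1).
Hypothesis hessM : forall x v, U x ->
  `|\sum_i \sum_j v 0 i * v 0 j * partial j (partial i Phi) x| <= M * dotp v v.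
Hypotheses (harm : harmonic_on U p) (p0const : const_on_components U p0).

Definition tangential (Phi p : V -> R) x :=
  dotp (grad p x) (grad p x) - dotp (grad Phi x) (grad p x) ^+ 2.
Definition normal (Phi p : V -> R) x := dotp (grad Phi x) (grad p x) ^+ 2.

Let oU : open U. Proof. exact: strip_open. Qed.

(** Segments inside a small ball of [U] are connected, so [p0] is locally constant; hence p - p0 is
    continuous and has the partial derivatives of p. *)
Lemma p0_near x : U x -> \forall y \near x, p y - p0 x = p y - p0 y.
Proof.
move=> Ux; have [r r0 Hr] := open_rV_ball oU Ux.
apply/nbhs_ballP; exists r => // y; rewrite -ball_normE /= => xy.
congr (_ - _); apply: p0const => //.
pose f (t : R) : V := x + t *: (y - x).
exists (f @` `[0, 1]%classic).
  split.
  - by exists 0; rewrite /= ?in_itv /= ?lexx ?ler01 // /f scale0r addr0.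
  - move=> z [t ht <-]; move: ht; rewrite /= in_itv /= => /andP[t0 t1]; apply: Hr.
    rewrite /f opprD addNKr normrN normrZ ger0_norm // distrC.
    by apply: le_lt_trans xy; rewrite ler_piMl.
  - apply: connected_continuous_connected; first exact: segment_connected.
    apply: continuous_subspaceT => t; apply: cvgD; first exact: cvg_cst.
    exact: scalel_continuous.
by exists 1; rewrite /= ?in_itv /= ?lexx ?ler01 // /f scale1r addrC subrK.
Qed.

Lemma q_cont x : U x -> {for x, continuous (fun y => p y - p0 y)}.
Proof.
move=> Ux; have cp : {for x, continuous (fun y => p y - p0 x)}.
  apply: cont_sub; last exact: (@cst_continuous V R _ x).
  exact/differentiable_continuous/harm.1.1.
apply: (cvg_trans (near_eq_cvg (p0_near Ux))); exact: cp.
Qed.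

Lemma q_derive i x : U x -> is_derive x (evec R i) (fun y => p y - p0 y) (partial i p x).
Proof.
move=> Ux; apply: near_eq_is_derive (p0_near Ux) _.
have H := @derivableP _ _ _ p x (evec R i) (diff_derivable (harm.1.1 x Ux)).
by apply: (is_derive_eq (is_deriveBf H (is_derive_cst (p0 x) x (evec R i)))); rewrite subr0.
Qed.

Lemma grad_dotp (f g : V -> R) x :
  dotp (grad f x) (grad g x) = \sum_j partial j f x * partial j g x.
Proof. by apply: eq_bigr => j _; rewrite !mxE. Qed.

Lemma tangential_ge0 x : U x -> 0 <= tangential Phi p x.
Proof.
move=> Ux; have := dotp_ge0 (grad p x - dotp (grad Phi x) (grad p x) *: grad Phi x).
rewrite !dotpE -(sqr_enorm (grad Phi x)) unitG // /tangential (dotpC (grad p x) (grad Phi x)).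
rewrite expr1n; move: (dotp (grad p x) _) (dotp (grad Phi x) _) => u d.
by rewrite expr2; lra.
Qed.

(** Evaluating the Hessian form on each basis vector isolates a diagonal entry. *)
Lemma lap_bound x : U x -> `|laplacian Phi x| <= N%:R * M.
Proof.
move=> Ux; apply: le_trans (ler_norm_sum _ _ _) _.
have -> : N%:R * M = \sum_(i < N) M by rewrite sumr_const card_ord mulr_natl.
apply: ler_sum => i _.
have E k : evec R i 0 k = (k == i)%:R by rewrite mxE.
have := hessM (evec R i) Ux.
have -> : dotp (evec R i) (evec R i) = 1.
  rewrite /dotp (bigD1 i) //= big1 ?addr0; first by rewrite E eqxx mulr1.
  by move=> k ki; rewrite E (negbTE ki) mul0r.
rewrite mulr1; congr (`|_| <= _).
rewrite (bigD1 i) //= [X in _ + X]big1 ?addr0; last first.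
  move=> k ki; apply: big1 => j _; by rewrite E (negbTE ki) !mul0r.
rewrite (bigD1 i) //= big1 ?addr0; first by rewrite E eqxx !mul1r.
by move=> k ki; rewrite !E (negbTE ki) mulr0 mul0r.
Qed.

Lemma hess_bound x : U x ->
  `|2 * (\sum_i \sum_j partial i (partial j Phi) x * partial j p x * partial i p x)
    - laplacian Phi x * dotp (grad p x) (grad p x)| <= (2 + N%:R) * M * dotp (grad p x) (grad p x).
Proof.
move=> Ux; have S0 := dotp_ge0 (grad p x).
have H1 := hessM (grad p x) Ux; have H2 := lap_bound Ux.
apply: le_trans (ler_normB _ _) _; rewrite !normrM (ger0_norm S0) (ger0_norm (ler0n R 2)).
rewrite (_ : (2 + N%:R) * M * _ = 2 * (M * dotp (grad p x) (grad p x))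
  + N%:R * M * dotp (grad p x) (grad p x)); last by ring.
apply: lerD; last by rewrite ler_wpM2r.
rewrite ler_wpM2l //; apply: le_trans H1; rewrite le_eqVlt; apply/orP; left; apply/eqP.
congr (`|_|); rewrite exchange_big; apply: eq_bigr => i _; apply: eq_bigr => j _.
by rewrite !mxE; ring.
Qed.

Lemma cont_grad_dotp (f g : V -> R) x : Ck 2 U f -> Ck 2 U g -> U x ->
  {for x, continuous (fun y => dotp (grad f y) (grad g y))}.
Proof.
move=> cf cg Ux.
rewrite (_ : (fun y => _) = (fun y => \sum_j partial j f y * partial j g y)); last first.
  by apply/funext => y; rewrite grad_dotp.
apply: cont_sum => j; apply: cont_mul; apply/differentiable_continuous.
  exact: (cf.2 j).1.
exact: (cg.2 j).1.
Qed.

Lemma cont_normal x : U x -> {for x, continuous (normal Phi p)}.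
Proof. move=> Ux; exact: (cont_exp (n := 2) (cont_grad_dotp cPhi harm.1 Ux)). Qed.

Lemma cont_tangential x : U x -> {for x, continuous (tangential Phi p)}.
Proof.
move=> Ux; apply: cont_sub; last exact: cont_normal.
exact: cont_grad_dotp harm.1 harm.1 Ux.
Qed.

Section Level.
Variable n : nat.
(** The cutoffs live on [a, s - a], while [window s n] is zero off [2 a, s - 2 a]: the gap gives the
    plateau room to rise. The offset 20 ensures [19 / 20 * s <= l], which limits the loss in the
    final constant. *)
Let a : R := s / (n + 20)%:R / 2.
Let l : R := s - 2 * a.

Lemma level_bounds : [/\ 0 < a, 0 < l, l <= s & 19 / 20 * s <= l].
Proof.
have n0 : 0 < (n + 20)%:R :> R by rewrite ltr0n addnS.
have a0 : 0 < a by rewrite /a !divr_gt0.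
have a2 : 2 * a <= s / 20.
  rewrite /a mulrCA divff ?mulr1 ?pnatr_eq0 // ler_pM2l // lef_pV2 ?posrE //.
  by rewrite ler_nat leq_addl.
split => //; rewrite /l; lra.
Qed.

Lemma plateau_index : exists2 k, (0 < k)%N & forall t : R,
  a / l <= t -> t <= 1 - a / l -> 1 - (1 - beta) / 2 <= plateau k t.
Proof.
have [a0 l0 ls l19] := level_bounds; have /andP[b0 b1] := beta01.
pose w0 := Num.max 0 (1 - 2 * (a / l)).
have al0 : 0 < a / l by rewrite divr_gt0.
have w00 : 0 <= w0 by rewrite le_max lexx.
have w01 : w0 < 1 by rewrite gt_max ltr01 /= gtrBl mulr_gt0.
have b20 : 0 < (1 - beta) / 2 by rewrite divr_gt0 // subr_gt0.
have C : (fun n => w0 ^+ n) @ \oo --> (0 : R) by apply: cvg_expr; rewrite ger0_norm.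
have /cvgrPdist_lt /(_ _ b20) [k0 _ Hk] := C.
exists k0.+1 => // t t1 t2.
have := Hk k0.+1 (leqnSn _); rewrite sub0r normrN ger0_norm ?exprn_ge0 // => wk.
apply: le_trans (_ : 1 - w0 ^+ k0.+1 <= _); first by rewrite lerD2l lerN2 ltW.
apply: plateau_far => //; last exact: ltW.
have : 1 - 2 * (a / l) <= w0 by rewrite le_max lexx orbT.
by move: (a / l) t1 t2 => z t1 t2 zw; rewrite ler_norml; apply/andP; split; lra.
Qed.

Lemma level_estimate : exists m,
  beta * rint N (windowed Omega s n (tangential Phi p)) 0 <=
  rint N (windowed Omega s m (normal Phi p)) 0
  + 24 / s ^+ 2 * rint N (windowed Omega s m (fun x => (p x - p0 x) ^+ 2)) 0.
Proof.
have [a0 l0 ls l19] := level_bounds; have /andP[b0 b1] := beta01.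
have [k k0 Hk] := plateau_index.
(* By [window_in], the right-hand window at this index equals 1 on the whole support of the
   cutoffs. *)
pose m := (8 * n + 140)%N; exists m.
have lne : l != 0 by rewrite gt_eqF.
pose F0 (r : R) := mollifier (rescale a l r).
pose F1 (r : R) := mollifier1 (rescale a l r) / l.
pose F2 (r : R) := mollifier2 (rescale a l r) / l / l.
pose H0 (r : R) := l * drift k (rescale a l r).
pose H1 (r : R) := drift1 k (rescale a l r).
have [p1 p2] := @mollifier_0 R; have [p3 p4] := @mollifier1_0 R; have [p5 p6] := @mollifier2_0 R.
have [p7 p8] := @drift_0 R k; have [p9 p10] := @drift1_0 R k.
have dF0 (r : R) : is_derive r (1 : R) F0 (F1 r) by exact: (rescale_is_derive _ _ _ (@is_derive_mollifier R)).
have dF1 (r : R) : is_derive r (1 : R) F1 (F2 r).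
  have H := @rescale_is_derive R mollifier1 mollifier2 a l r (@is_derive_mollifier1 R) p3 p4 p5 p6.
  have := is_derive_cstM l^-1 H.
  rewrite (_ : (fun y => _) = F1); last by apply/funext => t; rewrite mulrC.
  by move=> K; apply: (is_derive_eq K); rewrite mulrC.
have dH0 (r : R) : is_derive r (1 : R) H0 (H1 r).
  have H := @rescale_is_derive R (drift k) (drift1 k) a l r (@is_derive_drift R k) p7 p8 p9 p10.
  by apply: (is_derive_eq (is_derive_cstM l H)); rewrite mulrC divfK.
have derC (F F' : R -> R) : (forall r : R, is_derive r (1 : R) F (F' r)) -> continuous F.
  by move=> dF r; apply/differentiable_continuous/derivable1_diffP; have [] := dF r.
have ml := @rescale_continuous R.
have cmol2 : continuous (@mollifier2 R).
  move=> t; have idt : {for t, continuous (fun r : R => r)} by exact: cvg_id.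
  have kt c : {for t, continuous (fun _ : R => c : R)} by exact: (@cst_continuous R R c t).
  have ht := cont_mul idt (cont_sub (kt 1) idt).
  exact: (cont_sub (cont_mul (kt 840) ht) (cont_mul (kt 4200) (cont_exp (n := 2) ht))).
have cdrift1 : continuous (@drift1 R k).
  move=> t; have idt : {for t, continuous (fun r : R => r)} by exact: cvg_id.
  have kt c : {for t, continuous (fun _ : R => c : R)} by exact: (@cst_continuous R R c t).
  have ht := cont_mul idt (cont_sub (kt 1) idt).
  have c1 : {for t, continuous (@plateau R k)}.
    exact: (cont_sub (kt 1) (cont_exp (n := (2 * k)%N) (cont_sub (kt 1) (cont_mul (kt 2) idt)))).
  have c2 : {for t, continuous (@mollifier R)} by exact: (cont_mul (kt 140) (cont_exp (n := 3) ht)).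
  exact: (cont_sub c1 (cont_mul (kt (plateau_mass k)) c2)).
have cF2 : continuous F2.
  move=> t; have kt c : {for t, continuous (fun _ : R => c : R)} by exact: (@cst_continuous R R c t).
  exact: (cont_mul (cont_mul (@ml _ a l cmol2 t) (kt l^-1)) (kt l^-1)).
have cH1 : continuous H1 by exact: ml.
pose q x := p x - p0 x.
pose rd := rellich_div (fun i => partial i p) (fun i => partial i Phi)
  (fun i j => partial j (partial i Phi)) q Phi F0 F1 F2 H0 H1.
pose K := annulus Omega a (a + l).
have als : a + l = s - a by rewrite /l; ring.
have [harm1 harm2] := harm.
have out x : ~~ (a <= Phi x <= a + l) -> [/\ F0 (Phi x) = 0, F1 (Phi x) = 0,
    F2 (Phi x) = 0, H0 (Phi x) = 0 & H1 (Phi x) = 0].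
  move=> nK; rewrite /F0 /F1 /F2 /H0 /H1; rewrite (rescale_out l0 p1 p2 nK).
  rewrite (rescale_out l0 p3 p4 nK) (rescale_out l0 p5 p6 nK).
  rewrite (rescale_out l0 p7 p8 nK) (rescale_out l0 p9 p10 nK).
  by rewrite !mul0r mulr0.
have [Crd Ird] : Ctail 0 (zero_ext U rd) /\ rint N (zero_ext U rd) 0 = 0.
  have cK : closed K by exact: annulus_closed.
  have bK : bounded_set K by exact: annulus_bounded.
  have KU : K `<=` U by apply: annulus_sub; rewrite als gtrBl.
  have y1 i x : U x -> {for x, continuous (partial i p)}.
    by move=> Ux; exact/differentiable_continuous/(harm1.2 i).1.
  have y2 i x : U x -> {for x, continuous (partial i Phi)}.
    by move=> Ux; exact/differentiable_continuous/(cPhi.2 i).1.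
  have y3 i j x : U x -> {for x, continuous (partial j (partial i p))}.
    exact: (harm1.2 i).2.
  have y4 i j x : U x -> {for x, continuous (partial j (partial i Phi))}.
    exact: (cPhi.2 i).2.
  have y5 x : U x -> {for x, continuous Phi}.
    by move=> Ux; exact/differentiable_continuous/cPhi.1.
  have y6 i j x : U x -> is_derive x (evec R i) (partial j p) (partial i (partial j p) x).
    by move=> Ux; exact/derivableP/diff_derivable/(harm1.2 j).1.
  have y7 i j x : U x -> is_derive x (evec R i) (partial j Phi) (partial i (partial j Phi) x).
    by move=> Ux; exact/derivableP/diff_derivable/(cPhi.2 j).1.
  have y8 i x : U x -> is_derive x (evec R i) Phi (partial i Phi x).
    by move=> Ux; exact/derivableP/diff_derivable/cPhi.1.
  have y9 i j x : U x -> partial j (partial i p) x = partial i (partial j p) x.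
    by move=> Ux; exact: partialC oU harm1 _ _ _ Ux.
  have y10 x : U x -> \sum_i partial i Phi x * partial i Phi x = 1.
    by move=> Ux; rewrite -grad_dotp -sqr_enorm unitG // expr1n.
  have y11 x : U x -> ~ K x -> [/\ F0 (Phi x) = 0, F1 (Phi x) = 0,
      F2 (Phi x) = 0, H0 (Phi x) = 0 & H1 (Phi x) = 0].
    move=> Ux nK; apply: out; apply/negP => H; apply: nK.
    by split => //; case: Ux.
  have y12 i x (Ux : U x) : is_derive x (evec R i) q (partial i p x) := q_derive i Ux.
  exact: (@rint_rellich R N U K oU cK bK KU (fun i => partial i p) (fun i => partial i Phi)
    (fun i j => partial j (partial i p)) (fun i j => partial j (partial i Phi)) q Phi
    F0 F1 F2 H0 H1 y1 y2 y3 y4 q_cont y5 y6 y7 y12 y8 y9 harm2 y10 dF0 dF1 dH0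
    (derC _ _ dF0) (derC _ _ dF1) cF2 (derC _ _ dH0) cH1 y11).
pose e := 2 * s * ((2 + N%:R) * M).
have NM0 : 0 <= (2 + N%:R) * M by rewrite mulr_ge0 ?addr_ge0 // ltW.
have e0 : 0 <= e by rewrite /e !mulr_ge0 // ltW.
have k24 : 0 <= 24 / s ^+ 2 by rewrite divr_ge0 // sqr_ge0.
(* The extended [rd] integrates to zero, so a multiple of it may be added to the right side for
   free. *)
have pw x : beta * windowed Omega s n (tangential Phi p) x <=
    windowed Omega s m (normal Phi p) x + (24 / s ^+ 2 * windowed Omega s m (fun x => q x ^+ 2) x
      + (1 + e)^-1 * zero_ext U rd x).
  rewrite /windowed /zero_ext; case: asboolP => Ux; last by rewrite !mulr0 !addr0.
  have rg : 0 < Phi x < s := strip_range oO bO B0 Ux.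
  have T0 := tangential_ge0 Ux.
  have D0 : 0 <= normal Phi p x by exact: sqr_ge0.
  (* Off the support of the cutoffs [rd] and the left window are both zero, and nonnegative terms
     remain on the right. *)
  have [inK|nK] := boolP (a <= Phi x <= a + l); last first.
    have [z1 z2 z3 z4 z5] := out x nK.
    have -> : rd x = 0 by rewrite /rd /rellich_div z1 z2 z3 z4 z5; ring.
    rewrite window_out //; last first.
      apply: contra nK => /andP[h1 h2]; rewrite als.
      have aa : s / (n + 20)%:R = a + a by rewrite /a -splitr.
      by rewrite aa in h1 h2; apply/andP; split; lra.
    rewrite mul0r !mulr0 addr0; have /andP[W0 _] := window01 s m (Phi x).
    exact: addr_ge0 (mulr_ge0 W0 D0) (mulr_ge0 k24 (mulr_ge0 W0 (sqr_ge0 (q x)))).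
  have -> : window s m (Phi x) = 1 by apply: window_in => //; rewrite -als.
  rewrite !mul1r; have rs := rescale_in l0 inK.
  pose t := (Phi x - a) / l.
  have /andP[t0 t1] : 0 <= t <= 1 by rewrite /t -rs rescale01.
  have t01 : 0 <= t <= 1 by rewrite t0.
  have [/andP[ph0 _] [et0' et1]] := (mollifier_bounds t0 t1, plateau_bounds t0 t1 k0).
  have /andP[u0 _] := hump_bounds t0 t1.
  have et0 : 0 <= plateau k t by apply: le_trans et0'; rewrite mulr_ge0.
  pose hE := 2 * (\sum_i \sum_j partial i (partial j Phi) x * partial j p x * partial i p x)
    - laplacian Phi x * (tangential Phi p x + normal Phi p x).
  have SE : gsq (fun i => partial i p) x = tangential Phi p x + normal Phi p x.
    by rewrite /gsq -grad_dotp /tangential /normal subrK.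
  have rdE : rd x = mollifier t * (tangential Phi p x + normal Phi p x)
     + (plateau k t - plateau_mass k * mollifier t) * (tangential Phi p x - normal Phi p x)
     - 2^-1 * q x ^+ 2 * (F2 (Phi x) + F1 (Phi x) * laplacian Phi x) - l * drift k t * hE.
    rewrite /rd /rellich_div SE /F0 /H0 /H1 rs -/t /gdot -grad_dotp -/(normal Phi p x).
    rewrite /hE /drift1 /laplacian.
    move: (tangential _ _ _) (normal _ _ _) (\sum_i _) (\sum_i _) => T D A B.
    by ring.
  rewrite rdE; apply: pointwise_bound => //.
  - exact: plateau_mass_bounds.
  - by rewrite et0.
  - by rewrite e0.
  - exact: window01.
  - have [inn|nn] := boolP (s / (n + 20)%:R <= Phi x <= s - s / (n + 20)%:R); last first.
      by left; exact: window_out.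
    right; apply: Hk; rewrite /t.
      rewrite ler_pM2r ?invr_gt0 //; case/andP: inn.
      by rewrite (_ : s / _ = a + a); [move=> h1 h2; lra|rewrite /a -splitr].
    rewrite -[1](divff lne) -mulrBl ler_pM2r ?invr_gt0 //; case/andP: inn.
    by rewrite (_ : s / _ = a + a) /l; [move=> h1 h2; lra|rewrite /a -splitr].
  - have hd := drift_bound k0 t01.
    have S0 : 0 <= tangential Phi p x + normal Phi p x by exact: addr_ge0.
    have hb := hess_bound Ux.
    have SE2 : dotp (grad p x) (grad p x) = tangential Phi p x + normal Phi p x.
      by rewrite /tangential /normal subrK.
    rewrite SE2 -/hE in hb.
    apply: le_trans (ler_norm _) _; rewrite !normrM (gtr0_norm l0).
    apply: le_trans (_ : l * (2 * plateau k t) *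
        ((2 + N%:R) * M * (tangential Phi p x + normal Phi p x)) <= _).
      apply: ler_pM => //; first by rewrite mulr_ge0 // ltW.
      by rewrite ler_wpM2l // ltW.
    rewrite -subr_ge0 /e (_ : _ - _ = (s - l) * (2 * plateau k t *
      ((2 + N%:R) * M * (tangential Phi p x + normal Phi p x)))); last by ring.
    have sl0 : 0 <= s - l by rewrite subr_ge0.
    exact: mulr_ge0 sl0 (mulr_ge0 (mulr_ge0 (ler0n R 2) et0) (mulr_ge0 NM0 S0)).
  - have b2 := mollifier2_bound t.
    have b1' := mollifier1_bound t0 t1; have lb := lap_bound Ux.
    rewrite /F2 /F1 rs -/t.
    (* [z] measures the loss from using an interval shorter than the strip. *)
    pose z := s / l.
    have z0 : 0 < z by rewrite divr_gt0.
    have z1 : z <= 20 / 19 by rewrite /z ler_pdivrMr //; lra.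
    have zl : l^-1 = z / s by rewrite /z; field; rewrite !gt_eqF.
    have zs0 : 0 <= z / s := divr_ge0 (ltW z0) (ltW s0).
    have A1 : mollifier2 t / l / l <= 42 * (z ^+ 2 / s ^+ 2).
      rewrite -mulrA zl -expr2 expr_div_n ler_wpM2r // divr_ge0 ?sqr_ge0 //.
    have A2 : mollifier1 t / l * laplacian Phi x <= 27 * (z / s) * (N%:R * M).
      apply: le_trans (ler_norm _) _; rewrite normrM; apply: ler_pM => //.
      by rewrite normrM zl (ger0_norm zs0) ler_wpM2r.
    have A3 : 27 * (z / s) * (N%:R * M) <= 27 * z * (1 / 25) / s ^+ 2.
      rewrite (_ : 27 * (z / s) * _ = 27 * z * (N%:R * M * s) / s ^+ 2); last first.
        by field; rewrite gt_eqF.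
      by rewrite ler_wpM2r ?invr_ge0 ?sqr_ge0 // ler_wpM2l // mulr_ge0 // ltW.
    have z2 : z ^+ 2 <= 400 / 361.
      rewrite (_ : 400 / 361 = (20 / 19) ^+ 2 :> R); last by field.
      by rewrite lerXn2r ?nnegrE ?divr_ge0 // ltW.
    (* At [z = 20 / 19] the numerical factor is about 23.84, just below 24. *)
    apply: le_trans (_ : (42 * z ^+ 2 + 27 * z * (1 / 25)) / 2 / s ^+ 2 <= _).
      rewrite (_ : _ / s ^+ 2 = (42 * (z ^+ 2 / s ^+ 2) + 27 * z * (1 / 25) / s ^+ 2) / 2).
        by rewrite ler_pM2r ?invr_gt0 //; apply: lerD A1 (le_trans A2 A3).
      by ring.
    rewrite ler_wpM2r ?invr_ge0 ?sqr_ge0 //.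
    by move: (z ^+ 2) z2 => zz z2; lra.
have CT : Ctail 0 (windowed Omega s n (tangential Phi p)).
  by apply: Ctail_windowed => // x Ux; exact: cont_tangential.
have CN : Ctail 0 (windowed Omega s m (normal Phi p)).
  by apply: Ctail_windowed => // x Ux; exact: cont_normal.
have Cq : Ctail 0 (windowed Omega s m (fun x => q x ^+ 2)).
  by apply: Ctail_windowed => // x Ux; apply: cont_exp; exact: q_cont.
have := rint_le (leqnn N) (CtailZ beta CT) (CtailD CN (CtailD (CtailZ (24 / s ^+ 2) Cq)
  (CtailZ (1 + e)^-1 Crd))) pw 0.
rewrite (rintZ _ (leqnn N) CT) (rintD (leqnn N) CN (CtailD (CtailZ _ Cq) (CtailZ _ Crd))).
rewrite (rintD (leqnn N) (CtailZ _ Cq) (CtailZ _ Crd)) (rintZ _ (leqnn N) Cq).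
by rewrite (rintZ _ (leqnn N) Crd) Ird mulr0 addr0.
Qed.

End Level.
End StripEstimate.

(** * Choice of the strip width and passage to the limit *)

Unset Implicit Arguments. Set Strict Implicit. Set Printing Implicit Defensive.

Theorem theorem2p1 (R : realType) (N : nat) (Omega : set 'rV[R]_N)
    (beta1 s0 : R) :
  (2 <= N)%N ->
  bounded_domain Omega ->
  C3_boundary Omega ->
  beta1 < 1 ->
  0 < s0 ->
  Ck 3 (strip Omega s0) (distG Omega) ->
  (forall x, strip Omega s0 x -> enorm (grad (distG Omega) x) = 1) ->
  exists s1 : R, 0 < s1 < s0 /\
    forall (s : R) (p p0 : 'rV[R]_N -> R),
      0 < s < s1 ->
      harmonic_on (strip Omega s) p ->
      const_on_components (strip Omega s) p0 ->
      (beta1%:E *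
         integral_on (strip Omega s)
           (fun x => let a := grad p x in
                     let n := nvec Omega x in
                     (enorm (a - dotp n a *: n) ^+ 2)%R)
       <= integral_on (strip Omega s)
            (fun x => (dotp (nvec Omega x) (grad p x) ^+ 2)%R)
          + (24 / s ^+ 2)%R%:E *
            integral_on (strip Omega s) (fun x => ((p x - p0 x) ^+ 2)%R))%E.
Proof.
move=> N2 [[x0 Ox0] oO _ bO] C3 beta1lt1 s00 cPhi3 unitG.
have cPhi : Ck 2 (strip Omega s0) (distG Omega) := Ck_weaken cPhi3.
have B0 : bdry Omega !=set0.
  (* Otherwise [distG] is the infimum of the empty set, i.e. constantly [0], and
     its gradient is not a unit vector. *)
  apply: contrapT => nB.
  have D : distG Omega = cst 0.
    apply/funext => x; rewrite /distG.
    rewrite (_ : [set enorm (x - y) | y in bdry Omega] = set0) ?inf0 //.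
    by apply/seteqP; split => // r [y By _]; apply: nB; exists y.
  have := unitG x0; rewrite D (_ : grad (cst 0) x0 = 0); last first.
    by apply/rowP => i; rewrite !mxE /partial derive_cst.
  rewrite enorm0 => /(_ _)/eqP; rewrite eq_sym oner_eq0.
  by have S : strip Omega s0 x0; [split; rewrite ?D|move=> /(_ S)].
have [rho rho0 balls] := uniform_two_sided_ball oO bO C3.
pose M : R := 2 / rho; have M0 : 0 < M by rewrite divr_gt0.
have N0 : 0 < N%:R :> R by rewrite ltr0n (leq_trans _ N2).
have D1 : 0 < (2 + N%:R) * M by rewrite mulr_gt0 // addr_gt0.
have D2 : 0 < N%:R * M by rewrite mulr_gt0.
have b10 : 0 < 1 - beta1 by rewrite subr_gt0.
(* The four bounds serve, in order, to stay strictly inside the given strip, to apply the Hessian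
   bound, to make the Hessian error at most (1 - beta1) / 4 of the plateau term (8 is 2 times 4),
   and to keep the Laplacian term small enough for the constant 24. *)
pose s1 := Num.min (Num.min (s0 / 2) (rho / 2))
  (Num.min ((1 - beta1) / (8 * ((2 + N%:R) * M))) (1 / (25 * (N%:R * M)))).
have s10 : 0 < s1.
  by rewrite !lt_min !divr_gt0 // mulr_gt0.
exists s1; split.
  rewrite s10 /=; apply: le_lt_trans (_ : s0 / 2 < s0); last by lra.
  by rewrite /s1 !ge_min lexx.
move=> s p p0 /andP[s_gt0]; rewrite !lt_min => /andP[/andP[ss0 srho] /andP[sD1 sD2]] harm pc.
have cst1 : 0 <= 24 / s ^+ 2 by rewrite divr_ge0 // sqr_ge0.
have subU : strip Omega s `<=` strip Omega s0.
  by move=> x [Ox xs]; split => //; apply: lt_trans xs _; lra.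
have cPhis := Ck_sub subU cPhi.
have unitGs x : strip Omega s x -> enorm (grad (distG Omega) x) = 1 by move/subU/unitG.
have hess x (v : 'rV[R]_N) : strip Omega s x ->
    `|\sum_i \sum_j v 0 i * v 0 j * partial j (partial i (distG Omega)) x| <= M * dotp v v.
  move=> sx; apply: (hessian_distG_bound oO bO B0 v rho0 balls cPhi (subU _ sx)).
  by case: sx => _ xs; apply/ltW/(lt_trans xs).
rewrite (@eq_integral_on _ _ _ _ _ (tangential (distG Omega) p)); last first.
  move=> x Ux; cbv zeta; rewrite sqr_enorm /nvec /tangential !dotpE.
  rewrite -(sqr_enorm (grad (distG Omega) x)) unitGs //.
  rewrite (dotpC (grad p x) (grad (distG Omega) x)).
  move: (dotp (grad p x) _) (dotp (grad (distG Omega) x) _) => u d.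
  by rewrite expr1n; ring.
rewrite (@eq_integral_on _ _ _ _ (fun x => dotp (nvec Omega x) (grad p x) ^+ 2)
  (normal (distG Omega) p)); last first.
  by move=> x Ux; rewrite /nvec dotpNl sqrrN.
have T0 x : strip Omega s x -> 0 <= tangential (distG Omega) p x.
  exact: tangential_ge0.
have Q0 x : strip Omega s x -> 0 <= normal (distG Omega) p x by move=> _; exact: sqr_ge0.
have P0 x : strip Omega s x -> 0 <= (p x - p0 x) ^+ 2 by move=> _; exact: sqr_ge0.
(* For [beta1 <= 0] the left side is nonpositive and the right side nonnegative; the level estimate
   is for positive [beta1]. *)
have [bpos|bneg] := ltP 0 beta1; last first.
  apply: le_trans (_ : 0 <= _)%E; last first.
    by apply: adde_ge0; [|apply: mule_ge0; rewrite ?lee_fin //]; exact: integral_on_ge0.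
  by apply: mule_le0_ge0; [rewrite lee_fin|exact: integral_on_ge0].
have cq := q_cont oO bO B0 harm pc.
apply: integral_on_le => //.
- by move=> x Ux; apply: (cont_tangential cPhis harm).
- by move=> x Ux; apply: (cont_normal cPhis harm).
- by move=> x Ux; apply: (cont_exp (n := 2)); exact: cq.
move=> n; apply: (@level_estimate _ _ _ oO bO B0 s beta1 M) => //.
- by rewrite bpos.
- rewrite ltr_pdivlMr in sD1; last by rewrite mulr_gt0.
  by move: ((2 + N%:R) * M) sD1 => z sD1; lra.
- rewrite ltr_pdivlMr in sD2; last by rewrite mulr_gt0.
  by move: (N%:R * M) sD2 => z sD2; lra.
Qed.
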